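(* Let $K$ be a compact set in a Banach space $X$, and let $X_n$, $\Pi_n$, $\Lambda_n$ be generated by the generalized empirical interpolation method (defined in the context). There exists an absolute constant $C_0>0$ independent of $n$, $K$ and $X$ such that: (1) for a general Banach space $X$, we have $$\sup_{f\in K}\|f-\Pi_{n-1}f\|\le C_0(1+\Lambda_{n-1})\left(\prod_{k=1}^{n-1}(1+\Lambda_k)\right)^{\frac1n}n\,\varepsilon_n(\mathrm{co}(K));$$ (2) when $X=W^k_p(\Omega)$ with $p\in[1,\infty]$, it holds that $$\sup_{f\in K}\|f-\Pi_{n-1}f\|\le C_0(1+\Lambda_{n-1})\left(\prod_{k=1}^{n-1}(1+\Lambda_k)\right)^{\frac1n}n^{\frac12+|\frac12-\frac1p|}\,\varepsilon_n(\mathrm{co}(K));$$ (3) when $X$ is a Hilbert space, it holds that $$\sup_{f\in K}\|f-\Pi_{n-1}f\|\le C_0\Lambda_{n-1}\left(\Lambda_1\cdots\Lambda_{n-1}\right)^{\frac1n}n^{\frac12}\,\varepsilon_n(\mathrm{co}(K)).$$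
   Context: $\|\cdot\|$ is the norm of $X$. $W^k_p(\Omega)$ is the usual Sobolev space on a domain $\Omega$ of functions with weak derivatives up to order $k\ge0$ in $L_p(\Omega)$, with the convention $W^0_p(\Omega)=L_p(\Omega)$. Symmetric convex hull: $\mathrm{co}(K)$ is the closure in $X$ of $\{\sum_i c_ig_i:\ \sum_i|c_i|\le1,\ g_i\in K\text{ for each }i\}$. Entropy numbers: $\varepsilon_n(\mathrm{co}(K))=\inf\{\varepsilon>0:\ \mathrm{co}(K)\text{ is covered by }2^n\text{ balls of radius }\varepsilon\}$, with balls taken in $X$. Generalized empirical interpolation method (EIM). Input: a compact set $K\subset X$, a collection $\mathcal{L}$ of bounded linear functionals acting on $\mathrm{span}\{K\}$, and an integer $N\ge1$. Initialization: $X_0=\{0\}$, $\ell_0=0\in\mathcal{L}$, and $\Pi_0:X\to X_0$ is the zero map. For $n=1,\dots,N$: Step 1: select $f_n\in K$ such that $r_n:=f_n-\Pi_{n-1}f_n$ satisfies $\|r_n\|=\max_{f\in K}\|f-\Pi_{n-1}f\|$. Step 2: construct $X_n=\mathrm{span}\{f_1,\dots,f_n\}$. Step 3: select $\ell_n\in\mathcal{L}$ such that $|\ell_n(r_n)|=\max_{\ell\in\mathcal{L}}|\ell(r_n)|$. Step 4: let $g_n:=r_n/\ell_n(r_n)$ and $B_n=(\ell_i(g_j))_{1\le i,j\le n}$. Step 5: define the interpolation $\Pi_n:\mathrm{span}\{K\}\to X_n$ by $\Pi_nf=c_1g_1+\cdots+c_ng_n$, where $(c_1,\dots,c_n)^\top:=B_n^{-1}(\ell_1(f),\dots,\ell_n(f))^\top$.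 Standing assumption: the EIM is well-defined; then $B_n$ is lower triangular with unit diagonal entries, $g_1,\dots,g_n$ is a basis of $X_n$, and $\ell_1,\dots,\ell_n$ is unisolvent on $X_n$, so that $\Pi_n^2=\Pi_n$. Lebesgue constant: $\Lambda_n=\|\Pi_n\|_{K'}:=\sup_{0\ne g\in\mathrm{span}\{K\}}\|\Pi_ng\|/\|g\|$.
   Formalization: Part (3) is stated only for n ≥ 2: at n = 1 it is false as written, since Π_0 = 0 gives Λ_0 = 0, so the right-hand side is 0 while the left-hand side equals ‖f_1‖ > 0 for any well-defined EIM run. *)

(* Defs.v *)
From HB Require Import structures.
From mathcomp Require Import all_boot all_order all_algebra.
From mathcomp Require Import all_classical all_reals all_analysis.

Set Implicit Arguments.
Unset Strict Implicit.
Unset Printing Implicit Defensive.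

Import Order.TTheory GRing.Theory Num.Theory.
Import numFieldNormedType.Exports.

Local Open Scope classical_set_scope.
Local Open Scope ring_scope.

Section EIM.
Context {R : realType} {X : normedModType R}.
Implicit Types (K : set X) (L : set (X -> R)).

(* The algebraic linear span, not its closure. *)
Definition lspan K : set X :=
  [set x | exists (m : nat) (c : 'I_m -> R) (h : 'I_m -> X),
    (forall i, K (h i)) /\ x = \sum_i c i *: h i].

Definition sym_hull K : set X :=
  closure [set x | exists (m : nat) (c : 'I_m -> R) (h : 'I_m -> X),
    [/\ forall i, K (h i), \sum_i `|c i| <= 1 & x = \sum_i c i *: h i]].

Definition entropy_number (n : nat) (A : set X) : R :=
  inf [set e : R | 0 < e /\
    exists c : 'I_(2 ^ n) -> X, A `<=` \bigcup_(i in [set: 'I_(2 ^ n)]) ball (c i) e].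

(* Functionals on a subspace V are represented by functions on X whose values
   outside V are irrelevant. *)
Definition bounded_functional_on (V : set X) (l : X -> R) : Prop :=
  (forall (a : R) (u v : X), V u -> V v -> l (a *: u + v) = a * l u + l v) /\
  (exists M : R, forall u, V u -> `|l u| <= M * `|u|).

(* Sequences are indexed as in the algorithm, from 1, hence the shifts: the
   entry (i, j) of the matrix is ell_(i+1) (g_(j+1)). *)
Definition eim_matrix (ell : nat -> X -> R) (g : nat -> X) (n : nat) : 'M[R]_n :=
  \matrix_(i < n, j < n) ell i.+1 (g j.+1).

Definition eim_interp (ell : nat -> X -> R) (g : nat -> X) (n : nat) (f : X) : X :=
  \sum_(j < n)
    (invmx (eim_matrix ell g n) *m \col_(i < n) ell i.+1 f) j 0 *: g j.+1.

(* (f, ell, g) are the sequences produced by a well-defined run of N steps; the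
   maxima of the algorithm are attained at the selected f_n and ell_n. *)
Definition eim_run K L (N : nat) (f : nat -> X) (ell : nat -> X -> R)
    (g : nat -> X) : Prop :=
  [/\ L (ell 0%N),
      (forall u, lspan K u -> ell 0%N u = 0) &
      forall n : nat, (1 <= n <= N)%N ->
        let P := eim_interp ell g n.-1 in
        let r := f n - P (f n) in
        [/\ K (f n) /\ (forall h, K h -> `|h - P h| <= `|r|),
            L (ell n) /\ (forall l, L l -> `|l r| <= `|ell n r|),
            ell n r != 0 &
            g n = (ell n r)^-1 *: r]].

Definition lebesgue_constant K (ell : nat -> X -> R) (g : nat -> X) (n : nat) : R :=
  sup [set `|eim_interp ell g n h| / `|h| | h in [set h | lspan K h /\ h != 0]].

Definition eim_error K (ell : nat -> X -> R) (g : nat -> X) (n : nat) : R :=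
  sup [set `|h - eim_interp ell g n h| | h in K].

Definition hilbert_norm : Prop :=
  exists ip : {dot X for idfun}, forall x : X, ip x x = `|x| ^+ 2.

End EIM.
Arguments hilbert_norm {R} X.

(* Lebesgue measure on R^(d+1), by Caratheodory's construction from the outer
   measure given by countable covers with boxes. *)
Section LebesgueMeasure.
Context (R : realType) (d : nat).
Local Notation E := 'rV[R]_d.+1.

Definition box (ab : E * E) : set E :=
  [set x | forall i, ab.1 ord0 i < x ord0 i <= ab.2 ord0 i].

Definition box_volume (ab : E * E) : \bar R :=
  (\prod_i Num.max 0 (ab.2 ord0 i - ab.1 ord0 i))%:E.

Definition lebesgue_outer (A : set E) : \bar R :=
  ereal_inf [set (\sum_(k <oo) box_volume (B k))%E |
    B in [set B : nat -> E * E | A `<=` \bigcup_k box (B k)]].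

Local Open Scope ereal_scope.

Lemma box_volume_ge0 ab : 0 <= box_volume ab.
Proof. by rewrite lee_fin; apply: prodr_ge0 => i _; rewrite le_max lexx. Qed.

Lemma lebesgue_outer_ge0 A : 0 <= lebesgue_outer A.
Proof.
apply: le_ereal_inf_tmp => x [B AB <-{x}].
by apply: nneseries_ge0 => n _ _; exact: box_volume_ge0.
Qed.

Lemma le_lebesgue_outer : {homo lebesgue_outer : A B / A `<=` B >-> A <= B}.
Proof.
move=> A B AB; apply/ereal_inf_le_tmp => x [B' BB' <-{x}].
by exists B' => //; exact: subset_trans BB'.
Qed.

Lemma lebesgue_outer0 : lebesgue_outer set0 = 0.
Proof.
apply/eqP; rewrite eq_le lebesgue_outer_ge0 andbT.
apply: ereal_inf_lbound; exists (fun=> (0%R, 0%R)) => //=.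
apply: eseries0 => i _ _; rewrite /box_volume/= big_ord_recl !mxE subrr.
by rewrite maxxx mul0r.
Qed.

Lemma lebesgue_outer_sigma_subadditive : sigma_subadditive lebesgue_outer.
Proof.
move=> A; have [[i ioo]|] := pselect (exists i, lebesgue_outer (A i) = +oo).
  rewrite (eseries_pinfty _ _ ioo) ?leey// => n _.
  by rewrite -ltNye (lt_le_trans _ (lebesgue_outer_ge0 _)).
rewrite -forallNE => Aoo.
suff add2e (e : {posnum R}) :
    lebesgue_outer (\bigcup_n A n) <=
    \sum_(i <oo) lebesgue_outer (A i) + e%:num%:E.
  by apply/lee_addgt0Pr => _/posnumP[].
rewrite (le_trans _ (epsilon_trick _ _ _))//; last first.
  by move=> n; exact: lebesgue_outer_ge0.
pose P n (B : nat -> E * E) := A n `<=` \bigcup_k box (B k) /\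
  \sum_(k <oo) box_volume (B k) <=
    lebesgue_outer (A n) + (e%:num / (2 ^ n.+1)%:R)%:E.
have [G PG] : {G : nat -> nat -> E * E & forall n, P n (G n)}.
  apply: (@choice _ _ P) => n; rewrite /P /lebesgue_outer.
  set S := (X in ereal_inf X); move infS : (ereal_inf S) => iS.
  case: iS infS => [r Sr|Soo|Soo].
  - have en1 : (0 < e%:num / (2 ^ n.+1)%:R)%R by [].
    have /(lb_ereal_inf_adherent en1) : ereal_inf S \is a fin_num by rewrite Sr.
    move=> [x [B AnB muBx] xS].
    by exists B; split => //; rewrite muBx -Sr; exact/ltW.
  - by have := Aoo n; rewrite /lebesgue_outer Soo.
  - suff : lbound S 0 by move/le_ereal_inf_tmp; rewrite Soo.
    by move=> /= _ [B AnB <-]; apply: nneseries_ge0 => *; exact: box_volume_ge0.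
have muG_ge0 x : 0 <= (box_volume \o uncurry G) x by exact: box_volume_ge0.
apply: (@le_trans _ _ (\esum_(i in setT) (box_volume \o uncurry G) i)).
  apply: ereal_inf_lbound => /=.
  have /card_esym/ppcard_eqP[f] := card_nat2.
  exists (uncurry G \o f).
    apply: (@subset_trans _ (\bigcup_n \bigcup_k box (G n k))) => [t [i _]|].
      by move=> /(PG i).1 -[j _ ?]; exists i => //; exists j.
    move=> t [i _ [j _ Bijt]]; exists (f^-1%FUN (i, j)) => //=.
    by rewrite invK ?inE.
  rewrite -(esum_pred_image (box_volume \o uncurry G) _ xpredT) ?[fun=> _]set_true//.
  by rewrite image_eq.
rewrite (_ : esum _ _ = \sum_(i <oo) \sum_(j <oo ) box_volume (G i j)); last first.
  pose J : nat -> set (nat * nat) := fun i => [set (i, j) | j in setT].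
  rewrite (_ : setT = \bigcup_k J k); last first.
    by rewrite predeqE => -[a b]; split => // _; exists a => //; exists b.
  rewrite esum_bigcupT /=; last 2 first.
    - apply/trivIsetP => i j _ _ ij.
      rewrite predeqE => -[n m] /=; split => //= -[] [_] _ [<-{n} _].
      by move=> [m' _] [] /esym/eqP; rewrite (negbTE ij).
    - by move=> /= [n m]; exact: box_volume_ge0.
  rewrite -(image_id [set: nat]) -fun_true esum_pred_image//; last first.
    by move=> n _; apply: esum_ge0 => *; exact: box_volume_ge0.
  apply: eq_eseriesr => /= j _.
  rewrite -(esum_pred_image (box_volume \o uncurry G) (pair j) predT)//=;
    last 2 first.
    - by move=> n _; exact: box_volume_ge0.
    - by move=> ? ? _ _; exact: (@can_inj _ _ _ snd).
  by congr esum; rewrite predeqE => -[a b]; split; move=> [i _ <-]; exists i.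
apply: lee_lim.
- apply: is_cvg_nneseries => n *.
  by apply: nneseries_ge0 => m *; exact: (muG_ge0 (n, m)).
- by apply: is_cvg_nneseries => n *; apply: adde_ge0 => //; exact: lebesgue_outer_ge0.
- by near=> n; apply: lee_sum => i _; exact: (PG i).2.
Unshelve. all: by end_near. Qed.

HB.instance Definition _ := isOuterMeasure.Build R E lebesgue_outer
  lebesgue_outer0 lebesgue_outer_ge0 le_lebesgue_outer
  lebesgue_outer_sigma_subadditive.

Definition lebesgue_outer_measure : {outer_measure set E -> \bar R} :=
  lebesgue_outer.

Definition lebesgue_Rd :
    {measure set (caratheodory_type lebesgue_outer_measure) -> \bar R} :=
  [the measure _ _ of
    lebesgue_outer_measure : set (caratheodory_type lebesgue_outer_measure) -> _].

End LebesgueMeasure.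

Section Sobolev.
Context {R : realType} {d : nat}.
Local Notation E := 'rV[R]_d.+1.
Local Notation mu := (@lebesgue_Rd R d).
Implicit Types (Omega : set E) (u v phi : E -> R) (k : nat) (p : \bar R).

Definition domain Omega : Prop :=
  [/\ open Omega, connected Omega & Omega !=set0].

Definition partial (i : 'I_d.+1) phi : E -> R :=
  fun x => 'D_(delta_mx 0 i) phi x.

Definition iter_partial (s : seq 'I_d.+1) phi : E -> R := foldr partial phi s.

Definition smooth phi : Prop :=
  forall s : seq 'I_d.+1, continuous (iter_partial s phi) /\
    forall (i : 'I_d.+1) (x : E), derivable (iter_partial s phi) x (delta_mx 0 i).

Definition test_function Omega phi : Prop :=
  let supp := closure [set x | phi x != 0] in
  [/\ smooth phi, compact supp & supp `<=` Omega].

(* Entries are bounded by k so that the multi-indices of order at most k range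
   over a finite type. *)
Definition multi_index k := {ffun 'I_d.+1 -> 'I_k.+1}.

Definition mi_order k (a : multi_index k) : nat := (\sum_i a i)%N.

Definition mpartial k (a : multi_index k) phi : E -> R :=
  iter_partial (flatten [seq nseq (a i) i | i <- enum 'I_d.+1]) phi.

(* Functions on Omega are represented by functions on E whose values outside
   Omega are irrelevant; [u \_ Omega] is the extension of u by zero. *)
Definition in_Lp Omega p u : Prop := (u \_ Omega) \in Lfun mu p.

Definition Lp_norm Omega p u : R := fine ('N[mu]_p[EFin \o (u \_ Omega)])%E.

Definition is_weak_derivative Omega k (a : multi_index k) u v : Prop :=
  forall phi, test_function Omega phi ->
    Rintegral mu Omega (fun x => u x * mpartial a phi x) =
    (-1) ^+ mi_order a * Rintegral mu Omega (fun x => v x * phi x).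

Definition weak_derivatives_in_Lp Omega p k (a : multi_index k) u : set (E -> R) :=
  [set v | in_Lp Omega p v /\ is_weak_derivative Omega a u v].

Definition in_Wkp Omega k p u : Prop :=
  in_Lp Omega p u /\
  forall a : multi_index k, (mi_order a <= k)%N ->
    weak_derivatives_in_Lp Omega p a u !=set0.

Definition weak_derivative Omega p k (a : multi_index k) u : E -> R :=
  xget (fun=> 0) (weak_derivatives_in_Lp Omega p a u).

Definition Wkp_norm Omega k p u : R :=
  if p is q%:E then
    (\sum_(a : multi_index k | (mi_order a <= k)%N)
       Lp_norm Omega p (weak_derivative Omega p a u) `^ q) `^ q^-1
  else
    \big[Num.max/0]_(a : multi_index k | (mi_order a <= k)%N)
       Lp_norm Omega p (weak_derivative Omega p a u).

(* X is W^k_p(Omega), whose elements are classes of functions modulo equality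
   almost everywhere: rep chooses a function in the class of each element. *)
Definition is_Wkp (X : normedModType R) Omega k p : Prop :=
  exists rep : X -> E -> R,
    [/\ forall x, in_Wkp Omega k p (rep x),
        forall u, in_Wkp Omega k p u -> exists x, rep x = u %[ae mu in Omega],
        forall (a : R) (x y : X),
          rep (a *: x + y) = (fun t => a * rep x t + rep y t) %[ae mu in Omega] &
        forall x, `|x| = Wkp_norm Omega k p (rep x)].

End Sobolev.

(* Main.v *)
Require Import Defs.
From HB Require Import structures.
From mathcomp Require Import all_boot all_order all_algebra.
From mathcomp Require Import all_classical all_reals all_analysis measurable_realfun.
From mathcomp Require Import zify ring lra.
Set Implicit Arguments.
Unset Strict Implicit.
Unset Printing Implicit Defensive.
Import Order.TTheory GRing.Theory Num.Theory.
Import numFieldNormedType.Exports.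

Local Open Scope classical_set_scope.
Local Open Scope ring_scope.

(** Let [r_i] be the residual at step [i], [d_i := `|r_i| / (1 + Lambda_(i-1))]
and [X_i] the span of [f_1, ..., f_i].

The bounds follow from an estimate of the product of the [d_i]. The vector
[r_i] is the image of [f_i - y] under the projection [1 - Pi_(i-1)] for every
[y] in [X_(i-1)], so [f_i] is at distance at least [d_i] from [X_(i-1)]
([eim_triangular_widths]). The same projection argument gives
[`|r_n| <= (1 + Lambda_(n-1)) * `|r_i|] for [i <= n]
([eim_last_residual_le]). An estimate
[d_1 * ... * d_n <= (C * n `^ s * eps) ^+ n], valid whenever the symmetric hull
is covered by [2 ^ n] balls of radius [eps], therefore yields the stated bound
with exponent [s] after extracting an [n]-th root ([eim_bound]).

The product is estimated by counting lattice points, a discrete form of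
comparing volumes. The hull contains the points [\sum_i (m_i / (n * L)) *: f_i]
with [0 <= m_i < L]. Two of them in the same ball of radius [eps] that agree in
all coordinates after the [i]-th differ by a multiple of [f_i] plus an element
of [X_(i-1)], so that their [i]-th coordinates are within [2 * eps * n * L / d_i].
Hence a ball contains about [\prod_i (2 * eps * n * L / d_i)] of the [L ^ n]
points at most, which gives [s = 1] in every normed space ([prod_widths_le]).

The ball is described more precisely when the norm satisfies Clarkson's
inequality with an exponent [q] ([power_convex]). The quotient norms of the
[X / X_i] inherit this inequality. Along the chain of quotients the [q]-th
power of the norm of a point of the ball decreases by amounts whose sum is at
most [eps `^ q]; the amount lost at step [i] controls the deviation of the
[i]-th coordinate. Cutting the ball into at most [C ^ n] pieces according to
these losses makes each piece narrower by a factor [n `^ (- q^-1)] per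
coordinate on average, and [s = 1 - q^-1] ([prod_widths_le_power]).

It remains to see that the spaces of the theorem have the right exponent. In a
Hilbert space [q = 2] is the parallelogram identity, and [1 + Lambda_k] is at
most [2 * Lambda_k] because a nonzero projection has norm at least [1]. For
[W^k_p] with [1 < p < oo] the exponent is [q = max (p, p / (p - 1))]. The
scalar inequalities behind it ([clarkson_scalar_le2], [clarkson_scalar_ge2])
are linear in [p]-th powers, hence can be integrated and summed over
multi-indices ([sobolev_lifts_scalar_ineq]). This needs weak derivatives to be
linear up to null sets, that is, unique; uniqueness is the fundamental lemma of
the calculus of variations ([fundamental_lemma]), proved here for the measure
constructed from covers by boxes. For [p = 1] and [p = oo] the claim is that of
general spaces. *)

(** * Counting lattice points in sheared boxes *)

(** The [i]-th coordinates of two points of a class that agree after [i] are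
within [T i] of each other, so residues modulo [(T i).+1] tell them apart.
Looking at the last coordinate where two points of a class differ, one sees
that a point is determined by its class and the residues of its coordinates. *)
Lemma card_le_sheared_boxes (n L : nat) (Lab : finType) (A : pred Lab)
    (lab : {ffun 'I_n -> 'I_L} -> Lab) (T : Lab -> 'I_n -> nat) :
  (forall m, A (lab m)) ->
  (forall (m m' : {ffun 'I_n -> 'I_L}) (i : 'I_n), lab m = lab m' ->
     (forall j : 'I_n, (i < j)%N -> m j = m' j) ->
     (m i <= m' i + T (lab m) i)%N) ->
  (L ^ n <= \sum_(k | A k) \prod_i (T k i).+1)%N.
Proof.
move=> Alab shear.
have -> : (L ^ n = #|{ffun 'I_n -> 'I_L}|)%N by rewrite card_ffun !card_ord.
rewrite -sum1_card (partition_big lab A) //=.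
apply: leq_sum => k Ak; rewrite sum1dep_card.
pose res (m : {ffun 'I_n -> 'I_L}) : {dffun forall i, 'I_(T k i).+1} :=
  [ffun i => inZp (m i)].
have -> : (\prod_i (T k i).+1 = #|{dffun forall i, 'I_(T k i).+1}|)%N.
  rewrite card_dep_ffun foldrE big_map big_enum /=.
  by apply: eq_bigr => i _; rewrite card_ord.
rewrite -(@card_in_imset _ _ res) ?max_card// => m m'.
rewrite !inE => /eqP mk /eqP mk' mm'.
apply/ffunP; apply: contrapT => /existsNP [i0 /eqP neqi0].
(* i is the last coordinate where m and m' differ. *)
have [i neqi maxi] := @arg_maxnP _ i0 (fun i => m i != m' i) (fun i => i) neqi0.
have agree (j : 'I_n) : (i < j)%N -> m j = m' j.
  move=> ij; apply/eqP; apply: contraLR ij => /maxi.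
  by rewrite -leqNgt.
have := congr1 (fun F : {dffun forall i, 'I_(T k i).+1} => val (F i)) mm'.
rewrite !ffunE /= => modE.
have h1 := shear _ _ _ (etrans mk (esym mk')) agree.
have h2 := shear _ _ _ (etrans mk' (esym mk)) (fun j ij => esym (agree j ij)).
rewrite mk in h1; rewrite mk' in h2.
move/eqP: neqi; apply; apply/val_inj => /=.
wlog le : m m' h1 h2 modE mk mk' {mm' maxi agree neqi0} / (m i <= m' i)%N.
  by move=> W; case: (leqP (m i) (m' i)) => [|/ltnW] /W; [|move=> E; symmetry]; auto.
apply/eqP; rewrite eqn_leq le -subn_eq0 /=.
have /eqP := esym modE; rewrite eqn_mod_dvd// => /dvdnP [[|r]]; first by move=> ->.
move=> E; suff : (m' i - m i < (T k i).+1)%N by rewrite E mulSn -ltn_subRL subnn.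
by rewrite ltnS leq_subLR.
Qed.

(** On a fine grid the rounding in [card_le_sheared_boxes] at most doubles each
factor, and the power of [L] cancels: this is a bound on volumes expressed
without a measure. *)
Lemma prod_le_of_classes (R : realType) (n : nat) (Lab : finType) (A : pred Lab)
    (d : 'I_n -> R) (s : Lab -> 'I_n -> R) :
  (forall i, 0 < d i) -> (forall k i, 0 < s k i) ->
  (forall L : nat, (0 < L)%N -> exists lab : {ffun 'I_n -> 'I_L} -> Lab,
     (forall m, A (lab m)) /\
     forall (m m' : {ffun 'I_n -> 'I_L}) (i : 'I_n), lab m = lab m' ->
     (forall j : 'I_n, (i < j)%N -> m j = m' j) ->
     (m i)%:R - (m' i)%:R <= L%:R * s (lab m) i / d i) ->
  \prod_i d i <= \sum_(k | A k) \prod_i (2 * s k i).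
Proof.
move=> d0 s0 H.
(* L bounds every d i / s k i, so that adding 1 to a gap at most doubles it. *)
pose L := (\sum_k \sum_i Num.truncn (d i / s k i)).+1.
have L0 : (0 : R) < L%:R by rewrite ltr0n.
have Lbig k i : 1 <= L%:R * s k i / d i.
  rewrite ler_pdivlMr// mul1r -ler_pdivrMr//.
  apply: ltW; apply: (lt_le_trans (truncnS_gt _)).
  rewrite ler_nat /L ltnS (bigD1 k)//= (bigD1 i)//= -addnA leq_addr//.
have [lab [Alab Hlab]] := H L isT.
pose T k i := Num.truncn (L%:R * s k i / d i).
have /(card_le_sheared_boxes Alab) : forall (m m' : {ffun 'I_n -> 'I_L}) (i : 'I_n),
  lab m = lab m' -> (forall j : 'I_n, (i < j)%N -> m j = m' j) ->
     (m i <= m' i + T (lab m) i)%N.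
  move=> m m' i lm ag.
  rewrite -ltnS -(ltr_nat R) -addnS natrD -ltrBlDl.
  by apply: le_lt_trans (Hlab _ _ _ lm ag) _; exact: truncnS_gt.
rewrite -(ler_nat R) => le1.
have Ln : (0 : R) < L%:R ^+ n by rewrite exprn_gt0.
rewrite natrX in le1; rewrite -(ler_pM2l Ln).
have Pd : 0 < \prod_i d i by apply: prodr_gt0.
rewrite -(ler_pdivlMr _ _ Pd); apply: (le_trans le1).
rewrite natr_sum mulr_sumr mulr_suml; apply: ler_sum => k _.
have -> : L%:R ^+ n = \prod_(i < n) L%:R :> R by rewrite prodr_const card_ord.
rewrite natr_prod -prodfV -!big_split/=.
apply: ler_prod => i _; rewrite ler0n /= -natr1.
have h := Lbig k i.
have : (T k i)%:R <= L%:R * s k i / d i by rewrite truncn_le; lra.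
by move=> ?; lra.
Qed.

(** * Widths of a covered cross-polytope *)

Section Widths.
Context {R : realType} {X : normedModType R}.
Implicit Types (f : nat -> X) (d : nat -> R) (V : set X).

(** The space [X] may be infinite-dimensional, which excludes [{vspace X}]; the
coefficients form one sequence so that spans for different [i] are easy to
compare. *)
Definition lower_span f (i : nat) : set X :=
  [set y | exists c : nat -> R, y = \sum_(j < i) c j *: f j].

Lemma lower_span_linear f i (a : R) y z :
  lower_span f i y -> lower_span f i z -> lower_span f i (a *: y + z).
Proof.
move=> [c ->] [c' ->]; exists (fun j => a * c j + c' j).
rewrite scaler_sumr -big_split/=; apply: eq_bigr => j _.
by rewrite scalerDl scalerA.
Qed.

Lemma lower_span0 f i : lower_span f i 0.
Proof. by exists (fun=> 0); rewrite big1// => j _; rewrite scale0r. Qed.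

Lemma lower_spanZ f i (a : R) y : lower_span f i y -> lower_span f i (a *: y).
Proof.
by move=> /lower_span_linear /(_ (lower_span0 f i)) - /(_ a); rewrite addr0.
Qed.

Lemma lower_spanS f i y : lower_span f i y -> lower_span f i.+1 y.
Proof.
move=> [c ->]; exists (fun j => if (j < i)%N then c j else 0).
rewrite big_ord_recr /= ltnn scale0r addr0.
by apply: eq_bigr => j _; rewrite ltn_ord.
Qed.

(** Dividing by [n * L] keeps the whole grid in the cross-polytope. This grid
misses most of the lattice points of the cross-polytope, but only by a factor
exponential in [n], which the constants absorb. *)
Definition lattice_pt f (n L : nat) (m : {ffun 'I_n -> 'I_L}) : X :=
  \sum_(i < n) ((m i)%:R / (n%:R * L%:R)) *: f i.

Lemma lattice_ptB f n L (m m' : {ffun 'I_n -> 'I_L}) (i : 'I_n) :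
  (forall j : 'I_n, (i < j)%N -> m j = m' j) ->
  exists2 y, lower_span f i y &
    lattice_pt f m - lattice_pt f m' =
      (((m i)%:R - (m' i)%:R) / (n%:R * L%:R)) *: f i + y.
Proof.
move=> agree.
pose a (j : nat) : R := if insub j is Some j' then
  ((m j')%:R - (m' j')%:R) / (n%:R * L%:R) else 0.
have aE (j : 'I_n) : a j = ((m j)%:R - (m' j)%:R) / (n%:R * L%:R).
  by rewrite /a valK.
exists (\sum_(j < i) a j *: f j); first by exists a.
have -> : lattice_pt f m - lattice_pt f m' = \sum_(j < n) a j *: f j.
  rewrite -sumrB; apply: eq_bigr => j _.
  by rewrite aE -scalerBl mulrBl.
rewrite -aE -(big_mkord xpredT (fun j => a j *: f j)).
rewrite (@big_cat_nat _ _ _ i)//=; last exact: ltnW.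
rewrite addrC -(big_mkord xpredT (fun j => a j *: f j)); congr (_ + _).
rewrite big_ltn// big_nat big1 ?addr0// => j /andP[ij jn].
rewrite (aE (Ordinal jn)) agree//; by rewrite subrr mul0r scale0r.
Qed.

Lemma lattice_pt_coef n L (m : {ffun 'I_n -> 'I_L}) : (0 < n)%N -> (0 < L)%N ->
  \sum_(i < n) `|(m i)%:R / (n%:R * L%:R) : R| <= 1.
Proof.
move=> n0 L0; have nR : (0 : R) < n%:R by rewrite ltr0n.
have LR : (0 : R) < L%:R by rewrite ltr0n.
have E : \sum_(i < n) n%:R^-1 = 1 :> R.
  by rewrite sumr_const card_ord -[LHS]mulr_natr mulVf ?gt_eqF.
rewrite -[leRHS]E.
apply: ler_sum => i _; rewrite ger0_norm ?divr_ge0// ?mulr_ge0//.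
rewrite ler_pdivrMr ?mulr_gt0// mulKf ?gt_eqF//.
by rewrite ler_nat ltnW.
Qed.

Definition crosspolytope_covered f n (c : 'I_(2 ^ n) -> X) (e : R) :=
  forall t : 'I_n -> R, \sum_i `|t i| <= 1 ->
    exists j, `|c j - \sum_i t i *: f i| < e.

Lemma lattice_cover f n L (c : 'I_(2 ^ n) -> X) (e : R) :
  (0 < n)%N -> (0 < L)%N -> crosspolytope_covered f c e ->
  {lab : {ffun 'I_n -> 'I_L} -> 'I_(2 ^ n) |
    forall m, `|lattice_pt f m - c (lab m)| < e}.
Proof.
move=> n0 L0 cov.
have [lab Hlab] := @choice _ _ (fun (m : {ffun 'I_n -> 'I_L}) j => `|lattice_pt f m - c j| < e)
  (fun m => let: ex_intro j Hj := cov _ (lattice_pt_coef m n0 L0) in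
     ex_intro _ j (eq_rect _ (fun r => r < e) Hj _ (distrC _ _))).
by exists lab.
Qed.

Definition triangular_widths f d n :=
  forall i : 'I_n, 0 < d i /\ forall y, lower_span f i y -> d i <= `|f i + y|.

(** Homogeneity of the distance to the span of the earlier vectors. *)
Lemma width_scale f d n (i : 'I_n) (a : R) y : triangular_widths f d n ->
  lower_span f i y -> `|a| * d i <= `|a *: f i + y|.
Proof.
move=> /(_ i) [di Hd] Vy; have [->|a0] := eqVneq a 0.
  by rewrite normr0 mul0r.
have -> : a *: f i + y = a *: (f i + a^-1 *: y).
  by rewrite scalerDr scalerA mulfV// scale1r.
by rewrite normrZ ler_pM2l ?normr_gt0//; apply: Hd; exact: lower_spanZ.
Qed.

(** Two grid points in the same ball are closer than [2 * e], and their
difference has width at least [d i] times the gap of their last differing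
coordinates. *)
Lemma prod_widths_le f d n (c : 'I_(2 ^ n) -> X) (e : R) :
  (0 < n)%N -> 0 < e -> triangular_widths f d n -> crosspolytope_covered f c e ->
  \prod_(i < n) d i <= (8 * n%:R * e) ^+ n.
Proof.
move=> n0 e0 Hd cov; have nR : (0 : R) < n%:R by rewrite ltr0n.
pose s (_ : 'I_(2 ^ n)) (_ : 'I_n) := 2 * e * n%:R.
have s0 k i : 0 < s k i by rewrite /s !mulr_gt0.
have d0 (i : 'I_n) : 0 < d i by have [] := Hd i.
apply: le_trans (prod_le_of_classes (A := xpredT) d0 s0 _) _.
  move=> L L0; have [lab Hlab] := lattice_cover n0 L0 cov.
  exists lab; split => // m m' i mm' /(lattice_ptB f) [y Vy E].
  have LR : (0 : R) < L%:R by rewrite ltr0n.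
  have h1 := Hlab m; have h2 := Hlab m'; rewrite -mm' in h2.
  have : `|lattice_pt f m - lattice_pt f m'| <= 2 * e.
    rewrite (_ : _ - _ = (lattice_pt f m - c (lab m)) -
                         (lattice_pt f m' - c (lab m))); last first.
      by rewrite opprB addrA subrK.
    by apply: le_trans (ler_normB _ _) _; lra.
  rewrite E => /(le_trans (width_scale _ Hd Vy)).
  rewrite -(ler_pdivlMr _ _ (d0 i)) => H; move: (le_trans (ler_norm _) H).
  rewrite ler_pdivrMr ?mulr_gt0// => /le_trans; apply.
  by rewrite /s le_eqVlt; apply/orP; left; apply/eqP; field; rewrite gt_eqF.
have E k : \prod_i (2 * s k i) = (2 * (2 * e * n%:R)) ^+ n.
  by rewrite /s prodr_const card_ord.
rewrite (eq_bigr _ (fun k _ => E k)).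
rewrite big_const card_ord iter_addr_0 -[_ *+ _]mulr_natl natrX -exprMn le_eqVlt.
by apply/orP; left; apply/eqP; congr (_ ^+ _); ring.
Qed.

End Widths.

(** * Widths in spaces with a power-type convex norm *)

Lemma le_powR_cancel {R : realType} (q x y : R) :
  0 < q -> 0 <= x -> 0 <= y -> x `^ q <= y `^ q -> x <= y.
Proof.
move=> q0 x0 y0; rewrite !leNgt; apply: contraNN => yx.
exact: gt0_ltr_powR.
Qed.

Lemma midpoint_le {R : realType} (x y z : R) :
  x <= z -> y <= z -> 2^-1 * (x + y) <= z.
Proof. lra. Qed.

Section PowerConvex.
Context {R : realType} {X : normedModType R}.
Implicit Types (f : nat -> X) (d : nat -> R) (V : set X).

(** Clarkson's inequality with exponent [q], up to the constant [c] in the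
second term. The parallelogram identity is the case [q = 2], [c = 2^-1]. *)
Definition power_convex (q c : R) := forall x y : X,
  `|2^-1 *: (x + y)| `^ q + (c * `|x - y|) `^ q <= 2^-1 * (`|x| `^ q + `|y| `^ q).

(** The [q]-th power of the distance to [V], which is the [q]-th power of the
quotient norm of [X / V]. Powers are taken inside the infimum so that
approximate minimizers can be used without continuity of the power. *)
Definition dist_pow (q : R) V (x : X) : R := inf [set `|x + y| `^ q | y in V].

Lemma dist_pow_has_inf q f i x :
  has_inf [set `|x + y| `^ q | y in lower_span f i].
Proof.
split; first by exists (`|x + 0| `^ q); exists 0 => //; exact: lower_span0.
by exists 0 => _ [y _ <-]; exact: powR_ge0.
Qed.

Lemma dist_pow_le q f i x y : lower_span f i y ->
  dist_pow q (lower_span f i) x <= `|x + y| `^ q.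
Proof.
move=> Vy; apply: ge_inf; first by have [] := dist_pow_has_inf q f i x.
by exists y.
Qed.

Lemma dist_pow_ge q f i x r :
  (forall y, lower_span f i y -> r <= `|x + y| `^ q) ->
  r <= dist_pow q (lower_span f i) x.
Proof.
move=> H; apply: lb_le_inf; first by have [] := dist_pow_has_inf q f i x.
by move=> _ [y Vy <-]; exact: H.
Qed.

Lemma dist_pow_adherent q f i x (eta : R) : 0 < eta ->
  exists2 y, lower_span f i y &
    `|x + y| `^ q < dist_pow q (lower_span f i) x + eta.
Proof.
move=> eta0; have [_ [y Vy <-] lt] := inf_adherent eta0 (dist_pow_has_inf q f i x).
by exists y.
Qed.

Lemma dist_pow_shift q f i x v : lower_span f i v ->
  dist_pow q (lower_span f i) (x + v) = dist_pow q (lower_span f i) x.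
Proof.
have le x' v' : lower_span f i v' ->
  dist_pow q (lower_span f i) (x' + v') <= dist_pow q (lower_span f i) x'.
  move=> Vv; apply: dist_pow_ge => y Vy.
  have := @dist_pow_le q f i (x' + v') (- v' + y).
  rewrite addrA addrK; apply; rewrite -scaleN1r; exact: lower_span_linear.
move=> Vv; apply/eqP; rewrite eq_le le//=.
rewrite -[in leLHS](addrK v x); apply: le.
by rewrite -scaleN1r; exact: lower_spanZ.
Qed.

Lemma dist_powS q f i x :
  dist_pow q (lower_span f i.+1) x <= dist_pow q (lower_span f i) x.
Proof. by apply: dist_pow_ge => y /lower_spanS; exact: dist_pow_le. Qed.

Lemma dist_pow0 q f x : dist_pow q (lower_span f 0) x = `|x| `^ q.
Proof.
apply/eqP; rewrite eq_le; apply/andP; split.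
  by have := @dist_pow_le q f 0 x 0 (lower_span0 _ _); rewrite addr0.
by apply: dist_pow_ge => _ [c ->]; rewrite big_ord0 addr0.
Qed.

(** A quotient norm inherits power-type convexity: apply the inequality to
almost minimizing representatives of the two classes. *)
Lemma dist_pow_convex q c f i x x' (rho : R) : 0 <= q -> 0 <= c -> 0 <= rho ->
  power_convex q c ->
  (forall y, lower_span f i y -> rho <= `|x - x' + y|) ->
  dist_pow q (lower_span f i) (2^-1 *: (x + x')) + (c * rho) `^ q <=
  2^-1 * (dist_pow q (lower_span f i) x + dist_pow q (lower_span f i) x').
Proof.
move=> q0 c0 rho0 cvx Hrho; apply/ler_addgt0Pr => eta eta0.
have [y Vy lty] := dist_pow_adherent q f i x eta0.
have [y' Vy' lty'] := dist_pow_adherent q f i x' eta0.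
have := cvx (x + y) (x' + y').
have -> : 2^-1 *: (x + y + (x' + y')) = 2^-1 *: (x + x') + 2^-1 *: (y + y').
  by rewrite -scalerDr addrACA.
have -> : x + y - (x' + y') = (x - x') + (y - y') by rewrite opprD addrACA.
have V1 : lower_span f i (2^-1 *: (y + y')).
  by apply: lower_spanZ; rewrite -[y]scale1r; exact: lower_span_linear.
have V2 : lower_span f i (y - y').
  by rewrite addrC -scaleN1r; exact: lower_span_linear.
have h1 := dist_pow_le q (2^-1 *: (x + x')) V1.
have h2 : (c * rho) `^ q <= (c * `|x - x' + (y - y')|) `^ q.
  by apply: ge0_ler_powR; rewrite ?nnegrE ?mulr_ge0// ler_wpM2l ?Hrho.
lra.
Qed.

(** The loss of the [q]-th power of the distance when [f i] is added to the
span. The losses along the chain of spans telescope to at most [`|x| `^ q],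
while by [width_defect] two points with the same later coordinates and small
losses at [i] must have nearby [i]-th coordinates. *)
Definition defect q f i (x : X) : R :=
  dist_pow q (lower_span f i) x - dist_pow q (lower_span f i.+1) x.

Lemma defect_ge0 q f i x : 0 <= defect q f i x.
Proof. by rewrite subr_ge0 dist_powS. Qed.

Lemma sum_defect_le q f n x : \sum_(i < n) defect q f i x <= `|x| `^ q.
Proof.
rewrite -(big_mkord xpredT (fun i => defect q f i x)).
rewrite (telescope_sumr_eq (fun i => - dist_pow q (lower_span f i) x) _
  (leq0n n)); last first.
  by move=> k _; rewrite (opprK (dist_pow _ _ _)) [RHS]addrC.
rewrite (opprK (dist_pow _ _ _)) dist_pow0 addrC gerBl.
by apply: dist_pow_ge => y _; exact: powR_ge0.
Qed.

(** The midpoint of [x] and [x'] has the same distance to the larger span as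
both of them, and it is at least that far from the smaller span. Convexity in
the smaller quotient thus bounds the separation of [x] and [x'] by their
defects. *)
Lemma width_defect q c f d n (i : 'I_n) x x' (a : R) z :
  0 <= q -> 0 <= c -> power_convex q c -> triangular_widths f d n ->
  lower_span f i z -> x - x' = a *: f i + z ->
  (c * (`|a| * d i)) `^ q <= 2^-1 * (defect q f i x + defect q f i x').
Proof.
move=> q0 c0 cvx Hd Vz E; rewrite /defect.
have d0 : 0 < d i by have [] := Hd i.
have far y : lower_span f i y -> `|a| * d i <= `|x - x' + y|.
  move=> Vy; rewrite E -addrA; apply: (width_scale _ Hd).
  by rewrite -[z]scale1r; exact: lower_span_linear.
have := dist_pow_convex q0 c0 (mulr_ge0 (normr_ge0 a) (ltW d0)) cvx far.
have V1 : lower_span f i.+1 (a *: f i + z).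
  apply: lower_span_linear; last exact: lower_spanS.
  exists (fun j : nat => (j == i)%:R); rewrite big_ord_recr/= eqxx scale1r big1 ?add0r//.
  by move=> j _; rewrite ltn_eqF// scale0r.
have e1 : dist_pow q (lower_span f i.+1) x = dist_pow q (lower_span f i.+1) x'.
  by rewrite -(subrK x' x) E addrC dist_pow_shift.
have e2 : dist_pow q (lower_span f i.+1) (2^-1 *: (x + x')) =
          dist_pow q (lower_span f i.+1) x'.
  have -> : 2^-1 *: (x + x') = x' + 2^-1 *: (a *: f i + z).
    have half : x' = 2^-1 *: (x' + x').
      by rewrite -mulr2n -[x' *+ 2]scaler_nat scalerA mulVf// scale1r.
    rewrite -E; transitivity (2^-1 *: (x' + x') + 2^-1 *: (x - x')).
      by rewrite -scalerDr addrACA addrN addr0 addrC.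
    by rewrite -half.
  by rewrite dist_pow_shift//; exact: lower_spanZ.
have := dist_powS q f i (2^-1 *: (x + x')); rewrite e1 e2.
set u := _ `^ q; move: u (dist_pow q _ x) (dist_pow q _ x') => u v v'.
by set w := dist_pow q _ _; set w' := dist_pow q _ _ => h1 h2; lra.
Qed.

(** The arithmetic that turns the separation of two points whose defect has
label [k] into a bound on the gap of their [i]-th integer coordinates. *)
Lemma coordinate_gap (q c e a w : R) (k n L : nat) :
  1 <= q -> 0 < c -> 0 < e -> 0 < w -> (0 < n)%N -> (0 < L)%N ->
  (c * (`|a / (n%:R * L%:R)| * w)) `^ q <= e `^ q * k.+1%:R / n%:R ->
  a <= L%:R * (e * n%:R `^ (1 - q^-1) / c * k.+1%:R) / w.
Proof.
move=> q1 c0 e0 w0 n0 L0 H; have q0 : 0 < q by lra.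
have nR : (0 : R) < n%:R by rewrite ltr0n.
have LR : (0 : R) < L%:R by rewrite ltr0n.
have k0 : (0 : R) <= k.+1%:R by [].
have r0 := powR_ge0 (n%:R : R) (- q^-1).
have t0 : 0 <= `|a / (n%:R * L%:R)| * w by exact: mulr_ge0 (normr_ge0 _) (ltW w0).
have {H} : c * (`|a / (n%:R * L%:R)| * w) <= e * k.+1%:R * n%:R `^ (- q^-1).
  apply: (le_powR_cancel q0); [exact: mulr_ge0 (ltW c0) t0| |].
    exact: mulr_ge0 (mulr_ge0 (ltW e0) k0) r0.
  apply: (le_trans H).
  rewrite (powRM _ (mulr_ge0 (ltW e0) k0) r0) (powRM _ (ltW e0) k0).
  rewrite -(powRrM n%:R) mulNr mulVf ?(gt_eqF q0)// powR_inv1 ?ler0n//.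
  rewrite ler_pM2r ?invr_gt0// ler_pM2l ?powR_gt0//.
  by rewrite -[leLHS]powRr1// ler_powR// ler1n.
have -> : n%:R `^ (1 - q^-1) = n%:R * n%:R `^ (- q^-1) :> R.
  by rewrite powRD ?powRr1// (gt_eqF nR) implybT.
rewrite normrM normfV (gtr0_norm (mulr_gt0 nR LR)) => H.
rewrite ler_pdivlMr//; apply: le_trans (ler_wpM2r (ltW w0) (ler_norm _)) _.
have -> : `|a| * w = c * (`|a| / (n%:R * L%:R) * w) * (n%:R * L%:R / c).
  by field; rewrite (gt_eqF nR) (gt_eqF LR) (gt_eqF c0).
have -> : L%:R * (e * (n%:R * n%:R `^ (- q^-1)) / c * k.+1%:R) =
  e * k.+1%:R * n%:R `^ (- q^-1) * (n%:R * L%:R / c) by ring.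
by rewrite ler_pM2r// divr_gt0// mulr_gt0.
Qed.

(** The factor [4 ^ (n - \sum_i k i)] is at least [1] on the range of the sum
and decouples the coordinates; each of them contributes a geometric series. *)
Lemma sum_small_labels n :
  \sum_(k : {ffun 'I_n -> 'I_n.+1} | (\sum_i k i <= n)%N)
     \prod_i (k i).+1%:R <= 8 ^+ n :> R.
Proof.
have -> : 8 ^+ n = 4 ^+ n * 2 ^+ n :> R by rewrite -exprMn; congr (_ ^+ _); ring.
pose w (k : {ffun 'I_n -> 'I_n.+1}) : R := \prod_i (2^-1) ^+ (k i).
apply: (@le_trans _ _ (\sum_(k : {ffun 'I_n -> 'I_n.+1} | (\sum_i k i <= n)%N)
   4 ^+ n * w k)).
  apply: ler_sum => k kn.
  apply: (@le_trans _ _ (4 ^+ (\sum_i k i) * w k)); last first.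
    apply: ler_wpM2r; first by apply: prodr_ge0 => i _; rewrite exprn_ge0.
    by apply: ler_weXn2l => //; lra.
  rewrite expr_sum -big_split/=; apply: ler_prod => i _; rewrite ler0n/=.
  rewrite -exprMn (_ : 4 * 2^-1 = 2 :> R); last by field.
  by rewrite -natrX ler_nat; exact: ltn_expl.
rewrite -mulr_sumr ler_pM2l ?exprn_gt0//.
apply: (@le_trans _ _ (\sum_k w k)).
  rewrite big_mkcond; apply: ler_sum => k _; case: ifP => // _.
  by apply: prodr_ge0 => i _; rewrite exprn_ge0.
rewrite /w -(bigA_distr_bigA (fun (i : 'I_n) (j : 'I_n.+1) => 2^-1 ^+ j : R)).
rewrite prodr_const card_ord lerXn2r ?nnegrE ?sumr_ge0//.
rewrite -(big_mkord xpredT (fun j => 2^-1 ^+ j : R)).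
suff H : forall m, \sum_(0 <= j < m) 2^-1 ^+ j = 2 - 2 * 2^-1 ^+ m :> R.
  have : 0 <= 2^-1 ^+ n.+1 :> R by rewrite exprn_ge0.
  by move=> h; rewrite H; lra.
elim=> [|m IH]; first by rewrite big_nil expr0; ring.
by rewrite big_nat_recr//= IH exprS; field.
Qed.

(** Label a grid point by its ball and by the integer parts [k i] of
[n * defect / e `^ q]. The labels sum to at most [n], so on average [k i] is
bounded, and then the [i]-th coordinates of equally labelled points that agree
after [i] lie in an interval shorter by a factor [n `^ (- q^-1)] than the
diameter of the ball allows. *)
Lemma prod_widths_le_power q c f d n (b : 'I_(2 ^ n) -> X) (e : R) :
  1 <= q -> 0 < c -> power_convex q c ->
  (0 < n)%N -> 0 < e -> triangular_widths f d n -> crosspolytope_covered f b e ->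
  \prod_(i < n) d i <= (32 / c * n%:R `^ (1 - q^-1) * e) ^+ n.
Proof.
move=> q1 c0 cvx n0 e0 Hd cov; have nR : (0 : R) < n%:R by rewrite ltr0n.
have q0 : 0 <= q by exact: le_trans ler01 q1.
have eq0 : 0 < e `^ q by rewrite powR_gt0.
pose B := e * n%:R `^ (1 - q^-1) / c.
have B0 : 0 < B by rewrite divr_gt0 ?mulr_gt0 ?powR_gt0.
pose Lab := ('I_(2 ^ n) * {ffun 'I_n -> 'I_n.+1})%type.
pose s (k : Lab) (i : 'I_n) := B * (k.2 i).+1%:R.
have s0 k i : 0 < s k i by exact: mulr_gt0.
have d0 (i : 'I_n) : 0 < d i by have [] := Hd i.
apply: le_trans (prod_le_of_classes (A := fun k : Lab => (\sum_i k.2 i <= n)%N) d0 s0 _) _.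
  move=> L L0; have [ball Hball] := lattice_cover n0 L0 cov.
  have LR : (0 : R) < L%:R by rewrite ltr0n.
  pose z m := lattice_pt f m - b (ball m).
  pose t m (i : 'I_n) := Num.truncn (n%:R * defect q f i (z m) / e `^ q).
  have t0 m i : 0 <= n%:R * defect q f i (z m) / e `^ q.
    exact: divr_ge0 (mulr_ge0 (ltW nR) (defect_ge0 _ _ _ _)) (ltW eq0).
  have sumt m : (\sum_i t m i <= n)%N.
    rewrite -(ler_nat R) natr_sum.
    apply: (@le_trans _ _ (\sum_(i < n) n%:R * defect q f i (z m) / e `^ q)).
      by apply: ler_sum => i _; rewrite truncn_le.
    rewrite -mulr_suml -mulr_sumr -mulrA ler_piMr ?(ltW nR)// ler_pdivrMr// mul1r.
    apply: (le_trans (sum_defect_le _ _ _ _)); apply: ge0_ler_powR;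
      rewrite ?nnegrE ?normr_ge0 ?(ltW e0)//.
    exact: ltW (Hball m).
  pose lab m : Lab := (ball m, [ffun i => inord (t m i)]).
  have labE m i : (lab m).2 i = t m i :> nat.
    rewrite ffunE inordK// ltnS; apply: leq_trans (sumt m).
    by rewrite (bigD1 i)//= leq_addr.
  exists lab; split => [m|m m' i mm' /(lattice_ptB f) [y Vy E]].
    by rewrite (eq_bigr _ (fun i _ => labE m i)).
  have bb : ball m = ball m' := congr1 fst mm'.
  have tt : t m i = t m' i by rewrite -!labE mm'.
  have small m1 : defect q f i (z m1) <= e `^ q * (t m1 i).+1%:R / n%:R.
    have := ltW (truncnS_gt (n%:R * defect q f i (z m1) / e `^ q)).
    rewrite (ler_pdivrMr _ _ eq0) (ler_pdivlMr _ _ nR).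
    by rewrite [leLHS]mulrC [leRHS]mulrC.
  have E' : z m - z m' = (((m i)%:R - (m' i)%:R) / (n%:R * L%:R)) *: f i + y.
    by rewrite /z bb opprB addrA subrK.
  have close := width_defect q0 (ltW c0) cvx Hd Vy E'.
  rewrite /s labE; apply: (coordinate_gap q1 c0 e0 (d0 i) n0 L0).
  apply: (le_trans close); apply: midpoint_le (small m) _.
  by rewrite tt; exact: small.
have prodE (k : Lab) : \prod_i (2 * s k i) = (2 * B) ^+ n * \prod_i (k.2 i).+1%:R.
  have -> : (2 * B) ^+ n = \prod_(i < n) (2 * B) by rewrite prodr_const card_ord.
  by rewrite -big_split; apply: eq_bigr => i _; rewrite /s mulrA.
rewrite (eq_bigr _ (fun k _ => prodE k)) -mulr_sumr.
rewrite -(pair_big_dep xpredT (fun _ (k : {ffun 'I_n -> 'I_n.+1}) => (\sum_i k i <= n)%N)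
  (fun _ k => \prod_i (k i).+1%:R))/=.
have -> : (32 / c * n%:R `^ (1 - q^-1) * e) ^+ n = (2 * B) ^+ n * (8 ^+ n * 2 ^+ n).
  by rewrite -!exprMn /B; congr (_ ^+ _); ring.
have Bn0 : 0 < (2 * B) ^+ n by apply: exprn_gt0; apply: mulr_gt0.
rewrite (ler_pM2l Bn0).
rewrite big_const card_ord iter_addr_0 -[leLHS]mulr_natr natrX ler_wpM2r//.
exact: sum_small_labels.
Qed.

End PowerConvex.

(** * Algebra of the empirical interpolation *)

Section Span.
Context {R : realType} {X : normedModType R}.
Implicit Types (K : set X).

Lemma lspan_sub K x : K x -> lspan K x.
Proof.
move=> Kx; exists 1%N, (fun=> 1), (fun=> x); split => //.
by rewrite big_ord1 scale1r.
Qed.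

Lemma lspan_linear K (a : R) x y :
  lspan K x -> lspan K y -> lspan K (a *: x + y).
Proof.
move=> [m [c [h [Kh ->]]]] [m' [c' [h' [Kh' ->]]]].
exists (m + m')%N, (fun i => match fintype.split i with inl j => a * c j | inr j => c' j end),
  (fun i => match fintype.split i with inl j => h j | inr j => h' j end); split.
  by move=> i; case: fintype.split.
rewrite big_split_ord/= scaler_sumr; congr (_ + _); apply: eq_bigr => i _.
  by rewrite (unsplitK (inl i)) scalerA.
by rewrite (unsplitK (inr i)).
Qed.

Lemma lspan0 K x : lspan K x -> lspan K 0.
Proof. by move=> Vx; rewrite -(addNr x) -scaleN1r; exact: lspan_linear. Qed.

Lemma lspanZ K (a : R) x : lspan K x -> lspan K (a *: x).
Proof.
by move=> Vx; rewrite -[_ *: _]addr0; apply: lspan_linear => //; exact: lspan0 Vx.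
Qed.

Lemma lspanB K x y : lspan K x -> lspan K y -> lspan K (x - y).
Proof. by move=> Vx Vy; rewrite addrC -scaleN1r; exact: lspan_linear. Qed.

Lemma lspan_sum K z n (c : nat -> R) (h : nat -> X) : lspan K z ->
  (forall j, (j < n)%N -> lspan K (h j)) -> lspan K (\sum_(j < n) c j *: h j).
Proof.
move=> Vz; elim: n => [|n IH] Vh; first by rewrite big_ord0; exact: lspan0 Vz.
rewrite big_ord_recr/= addrC; apply: lspan_linear; first exact: Vh.
by apply: IH => j jn; apply: Vh; exact: ltnW.
Qed.

Lemma bounded_functional_sum K (l : X -> R) z n (c : nat -> R) (h : nat -> X) :
  bounded_functional_on (lspan K) l -> lspan K z ->
  (forall j, (j < n)%N -> lspan K (h j)) ->
  l (\sum_(j < n) c j *: h j) = \sum_(j < n) c j * l (h j).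
Proof.
move=> [lin _] Vz; elim: n => [|n IH] Vh.
  rewrite !big_ord0; have /= := lin 1 _ _ (lspan0 Vz) (lspan0 Vz).
  rewrite scale1r addr0 mul1r => /eqP; rewrite -subr_eq0 opprD addrA subrr add0r.
  by rewrite oppr_eq0 => /eqP.
have Vh' j : (j < n)%N -> lspan K (h j) by move=> jn; apply: Vh; exact: ltnW.
rewrite !big_ord_recr/= addrC lin; [|exact: Vh|exact: lspan_sum Vz Vh'].
by rewrite IH// addrC.
Qed.

End Span.

Section EIMRun.
Context {R : realType} {X : normedModType R}.
Variables (K : set X) (L : set (X -> R)) (N : nat) (f : nat -> X)
  (ell : nat -> X -> R) (g : nat -> X).
Hypothesis bL : forall l, L l -> bounded_functional_on (lspan K) l.
Hypothesis run : eim_run K L N f ell g.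

Local Notation P := (eim_interp ell g).
Local Notation V := (lspan K).
Local Notation F := (fun j => f j.+1).
Local Notation G := (fun j => g j.+1).

Lemma eim_ell_bounded n : (n < N)%N -> bounded_functional_on V (ell n.+1).
Proof. by move=> nN; have [_ _ /(_ n.+1 nN) [_ [/bL]]] := run. Qed.

Lemma eim_f_lspan n : (n < N)%N -> V (f n.+1).
Proof. by move=> nN; have [_ _ /(_ n.+1 nN) [[/lspan_sub]]] := run. Qed.

(** Coefficients as a sequence, extended by [0] beyond [n], to match
[lower_span]. *)
Definition eim_coef n (h : X) (j : nat) : R :=
  if insub j is Some j' then
    (invmx (eim_matrix ell g n) *m \col_(i < n) ell i.+1 h) j' 0 else 0.

Lemma eim_interpE n h : P n h = \sum_(j < n) eim_coef n h j *: g j.+1.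
Proof. by apply: eq_bigr => j _; rewrite /eim_coef valK. Qed.

Lemma eim_interp_coef n (c : nat -> R) h :
  eim_matrix ell g n \in unitmx ->
  (forall i : 'I_n, ell i.+1 h = \sum_(j < n) c j * ell i.+1 (g j.+1)) ->
  P n h = \sum_(j < n) c j *: g j.+1.
Proof.
move=> U E; apply: eq_bigr => j _; congr (_ *: _).
have -> : \col_(i < n) ell i.+1 h = eim_matrix ell g n *m \col_(i < n) c i.
  by apply/colP => i; rewrite !mxE E; apply: eq_bigr => k _; rewrite !mxE mulrC.
by rewrite mulKmx// mxE.
Qed.

Lemma eim_coef_interp n h : eim_matrix ell g n \in unitmx -> forall i : 'I_n,
  ell i.+1 h = \sum_(j < n) eim_coef n h j * ell i.+1 (g j.+1).
Proof.
move=> U i.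
have : eim_matrix ell g n *m (invmx (eim_matrix ell g n) *m \col_(i < n) ell i.+1 h) =
  \col_(i < n) ell i.+1 h by rewrite mulKVmx.
move=> /colP /(_ i); rewrite [RHS]mxE => <-; rewrite mxE.
by apply: eq_bigr => j _; rewrite /eim_coef valK mxE mulrC.
Qed.

(** Since [Pi_n] interpolates at [ell_1, ..., ell_n], these functionals vanish
on the residual of [f_(n+1)], hence on [g_(n+1)]. Together with the
normalization [ell_(n+1) (g_(n+1)) = 1] this makes the next matrix unit
triangular, and the induction continues. *)
Lemma eim_triangular n : (n <= N)%N ->
  (forall j, (j < n)%N -> V (g j.+1)) /\
  (forall i j, (i <= j)%N -> (j < n)%N -> ell i.+1 (g j.+1) = (i == j)%:R).
Proof.
elim: n => [|n IH] nN; first by [].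
have [Vg tri] := IH (ltnW nN).
have U : eim_matrix ell g n \in unitmx.
  rewrite unitmxE det_trig; last first.
    apply/is_trig_mxP => i j ij; rewrite mxE tri ?ltn_ord//; last exact: ltnW.
    by rewrite ltn_eqF.
  by rewrite big1 ?unitr1// => i _; rewrite mxE tri ?ltn_ord// eqxx.
have [_ _ /(_ n.+1 nN) /=] := run.
set r := f n.+1 - _ => -[_ _ r0 gE].
have VP : V (P n (f n.+1)).
  by rewrite eim_interpE; exact: lspan_sum (eim_f_lspan nN) Vg.
have Vr : V r by apply: lspanB VP; exact: eim_f_lspan.
have Vgn : V (g n.+1) by rewrite gE; exact: lspanZ.
split=> [j|i j ij]; rewrite ltnS leq_eqVlt => /predU1P[jn|jn].
- by rewrite jn.
- exact: Vg.
- rewrite {j}jn in ij *.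
have iN : (i < N)%N by exact: leq_ltn_trans ij nN.
  have [lin _] := eim_ell_bounded iN.
  have linZ a x : V x -> ell i.+1 (a *: x) = a * ell i.+1 x.
    move=> Vx; have := @bounded_functional_sum _ _ _ _ x 1 (fun=> a) (fun=> x) (eim_ell_bounded iN) Vx.
    by rewrite !big_ord1; apply.
  rewrite gE linZ//; move: ij; rewrite leq_eqVlt => /predU1P[->|ilt].
    by rewrite eqxx mulVf.
  rewrite ltn_eqF// /r addrC -scaleN1r lin//; last exact: eim_f_lspan.
  rewrite mulN1r eim_interpE (bounded_functional_sum _ (eim_ell_bounded iN) (eim_f_lspan nN) Vg).
  by rewrite -(eim_coef_interp _ U (Ordinal ilt))/= addNr mulr0.
- exact: tri.
Qed.

Lemma eim_matrix_unit n : (n <= N)%N -> eim_matrix ell g n \in unitmx.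
Proof.
move=> /eim_triangular [_ tri]; rewrite unitmxE det_trig; last first.
  apply/is_trig_mxP => i j ij; rewrite mxE tri ?ltn_ord//; last exact: ltnW.
  by rewrite ltn_eqF.
by rewrite big1 ?unitr1// => i _; rewrite mxE tri ?ltn_ord// eqxx.
Qed.

Lemma eim_interp_lspan n h : (n <= N)%N -> V h -> V (P n h).
Proof.
move=> nN Vh; rewrite eim_interpE; exact: lspan_sum Vh (eim_triangular nN).1.
Qed.

(** The coefficients of [y] solve the triangular system that defines [Pi_n y]. *)
Lemma eim_interp_id n y : (n <= N)%N -> lower_span G n y -> P n y = y.
Proof.
move=> nN [c ->]; apply: eim_interp_coef (eim_matrix_unit nN) _ => i.
have iN : (i < N)%N by exact: leq_trans nN.
have Vg := (eim_triangular nN).1.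
exact: bounded_functional_sum (eim_ell_bounded iN) (eim_f_lspan iN) Vg.
Qed.

Lemma eim_interp_lower n h : lower_span G n (P n h).
Proof. by exists (eim_coef n h); exact: eim_interpE. Qed.

Lemma eim_interp_linear n (a : R) x y : (n <= N)%N -> V x -> V y ->
  P n (a *: x + y) = a *: P n x + P n y.
Proof.
move=> nN Vx Vy; pose c j := a * eim_coef n x j + eim_coef n y j.
rewrite (@eim_interp_coef n c); first last.
- move=> i; have iN : (i < N)%N by exact: leq_trans nN.
  have [lin _] := eim_ell_bounded iN; rewrite lin//.
  rewrite (eim_coef_interp x (eim_matrix_unit nN)) (eim_coef_interp y (eim_matrix_unit nN)).
  rewrite mulr_sumr -big_split/=; apply: eq_bigr => j _.
  by rewrite /c mulrDl mulrA.
- exact: eim_matrix_unit.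
rewrite !eim_interpE scaler_sumr -big_split/=; apply: eq_bigr => j _.
by rewrite scalerDl scalerA.
Qed.

Lemma eim_interpB n x y : (n <= N)%N -> V x -> V y -> P n (x - y) = P n x - P n y.
Proof.
move=> nN Vx Vy.
by rewrite addrC -scaleN1r eim_interp_linear// scaleN1r addrC.
Qed.

Lemma lower_span_mono (h : nat -> X) m n y : (m <= n)%N ->
  lower_span h m y -> lower_span h n y.
Proof. by move=> /subnK <-; elim: (_ - _)%N y => // k IH y /IH; exact: lower_spanS. Qed.

(** By induction, since [f_n] is a multiple of [g_n] plus [Pi_(n-1) f_n]. *)
Lemma eim_lower_span n y : (n <= N)%N -> lower_span F n y -> lower_span G n y.
Proof.
move=> nN [c ->]; elim: n nN => [|n IH] nN; first by rewrite big_ord0; exact: lower_span0.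
rewrite big_ord_recr/= addrC; apply: lower_span_linear; last first.
  by apply: lower_spanS; exact: IH (ltnW nN).
have [_ _ /(_ n.+1 nN) /=] := run; set r := f n.+1 - _ => -[_ _ r0 gE].
have -> : f n.+1 = ell n.+1 r *: g n.+1 + P n (f n.+1).
  by rewrite gE scalerA mulfV// scale1r subrK.
apply: lower_span_linear; last by apply: lower_spanS; exact: eim_interp_lower.
exists (fun j : nat => (j == n)%:R); rewrite big_ord_recr/= eqxx scale1r big1 ?add0r//.
by move=> j _; rewrite ltn_eqF// scale0r.
Qed.

Lemma eim_interp_bounded n : (n <= N)%N ->
  exists M : R, forall h, V h -> `|P n h| <= M * `|h|.
Proof.
move=> nN.
have /choice[M HM] : forall i : 'I_n, exists M : R, forall u, V u -> `|ell i.+1 u| <= M * `|u|.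
  by move=> i; have [_] := eim_ell_bounded (leq_trans (ltn_ord i) nN).
pose A := invmx (eim_matrix ell g n).
exists (\sum_(j < n) (\sum_(i < n) `|A j i| * M i) * `|g j.+1|) => h Vh.
rewrite mulr_suml; apply: (le_trans (ler_norm_sum _ _ _)); apply: ler_sum => j _.
rewrite normrZ mulrAC ler_wpM2r// mxE mulr_suml.
apply: (le_trans (ler_norm_sum _ _ _)); apply: ler_sum => i _.
by rewrite mxE normrM -mulrA ler_wpM2l// HM.
Qed.

Local Notation Lam := (lebesgue_constant K ell g).

Lemma eim_ell0 n : (n < N)%N -> ell n.+1 0 = 0.
Proof.
move=> nN.
have := @bounded_functional_sum _ _ _ _ _ 0 (fun=> 0) (fun=> 0)
    (eim_ell_bounded nN) (eim_f_lspan nN) (fun _ _ => lspan0 (eim_f_lspan nN)).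
by rewrite !big_ord0.
Qed.

Lemma eim_g1_neq0 : (0 < N)%N -> g 1%N != 0.
Proof.
move=> N0; apply/eqP => g0.
have := (eim_triangular N0).2 0%N 0%N (leqnn _) isT.
by rewrite g0 eim_ell0// => /eqP; rewrite eq_sym oner_eq0.
Qed.

Lemma lebesgue_has_sup n : (0 < N)%N -> (n <= N)%N ->
  has_sup [set `|P n h| / `|h| | h in [set h | V h /\ h != 0]].
Proof.
move=> N0 nN; split.
  exists (`|P n (g 1%N)| / `|g 1%N|); exists (g 1%N) => //; split.
    exact: (eim_triangular N0).1.
  exact: eim_g1_neq0.
have [M HM] := eim_interp_bounded nN.
exists M => _ [h [Vh h0] <-].
by rewrite ler_pdivrMr ?normr_gt0// HM.
Qed.

Lemma le_lebesgue n h : (0 < N)%N -> (n <= N)%N -> V h -> `|P n h| <= Lam n * `|h|.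
Proof.
move=> N0 nN Vh; have [->|h0] := eqVneq h 0.
  have -> : P n 0 = 0 by apply: eim_interp_id => //; exact: lower_span0.
  by rewrite !normr0 mulr0.
rewrite -ler_pdivrMr ?normr_gt0//; apply: ub_le_sup.
  by have [] := lebesgue_has_sup N0 nN.
by exists h.
Qed.

(** The interpolation fixes the nonzero vector [g_1]. *)
Lemma lebesgue_ge1 n : (0 < n <= N)%N -> 1 <= Lam n.
Proof.
move=> /andP[n0 nN]; have N0 := leq_trans n0 nN.
have Vg : V (g 1%N) := (eim_triangular N0).1 0%N isT.
have g0 := eim_g1_neq0 N0.
have := le_lebesgue N0 nN Vg; rewrite eim_interp_id//.
  by rewrite -ler_pdivrMr ?normr_gt0// divff ?normr_eq0.
apply: (@lower_span_mono _ 1) => //; exists (fun=> 1).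
by rewrite big_ord1 scale1r.
Qed.

Lemma lebesgue0 : (0 < N)%N -> Lam 0 = 0.
Proof.
move=> N0; apply/eqP; rewrite eq_le; apply/andP; split.
  apply: ge_sup; first by have [] := lebesgue_has_sup N0 (leq0n N).
  by move=> _ [h _ <-]; rewrite /eim_interp big_ord0 normr0 mul0r.
apply: (@le_trans _ _ (`|P 0 (g 1%N)| / `|g 1%N|)); first by rewrite divr_ge0.
apply: ub_le_sup; first by have [] := lebesgue_has_sup N0 (leq0n N).
by exists (g 1%N) => //; split; [exact: (eim_triangular N0).1|exact: eim_g1_neq0].
Qed.

End EIMRun.

(** * From widths to the interpolation error *)

Section Reduction.
Context {R : realType} {X : normedModType R}.
Variables (K : set X) (L : set (X -> R)) (N : nat) (f : nat -> X)
  (ell : nat -> X -> R) (g : nat -> X).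
Hypothesis bL : forall l, L l -> bounded_functional_on (lspan K) l.
Hypothesis run : eim_run K L N f ell g.

Local Notation P := (eim_interp ell g).
Local Notation V := (lspan K).
Local Notation F := (fun j => f j.+1).
Local Notation Lam := (lebesgue_constant K ell g).
Local Notation res i := (f i.+1 - P i (f i.+1)).

Lemma lebesgue_ge0 n : (n <= N)%N -> (0 < N)%N -> 0 <= Lam n.
Proof.
move=> nN N0; case: n nN => [|n] nN; first by rewrite (lebesgue0 bL run).
by apply: le_trans (ler01) _; exact: (lebesgue_ge1 bL run).
Qed.

Lemma eim_residual_gt0 i : (i < N)%N -> 0 < `|res i|.
Proof.
move=> iN; rewrite normr_gt0; apply/eqP => r0.
have [_ _ /(_ i.+1 iN) /=] := run; rewrite r0 => -[_ _ +_].
by rewrite (eim_ell0 bL run)// eqxx.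
Qed.

(** The projection [1 - Pi_n] vanishes at [y] and has norm at most
[1 + Lambda_n]. *)
Lemma eim_residual_le n h y : (n <= N)%N -> (0 < N)%N -> V h -> V y ->
  lower_span (fun j => g j.+1) n y ->
  `|h - P n h| <= (1 + Lam n) * `|h - y|.
Proof.
move=> nN N0 Vh Vy ly.
have -> : h - P n h = (h - y) - P n (h - y).
  rewrite (eim_interpB bL run)// (eim_interp_id bL run nN ly).
  by rewrite opprB addrA subrK.
rewrite mulrDl mul1r; apply: (le_trans (ler_normB _ _)).
by rewrite lerD2l (le_lebesgue bL run)//; exact: lspanB.
Qed.

Lemma eim_triangular_widths n : (n <= N)%N ->
  triangular_widths F (fun i => `|res i| / (1 + Lam i)) n.
Proof.
move=> nN i; have iN : (i < N)%N by exact: leq_trans (ltn_ord i) nN.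
have N0 : (0 < N)%N by exact: leq_ltn_trans iN.
have L0 : 0 < 1 + Lam i by rewrite ltr_pwDl// lebesgue_ge0// ltnW.
split; first by rewrite divr_gt0// eim_residual_gt0.
move=> y ly; rewrite ler_pdivrMr// mulrC -[y]opprK.
have lFy : lower_span F i (- y) by rewrite -scaleN1r; exact: lower_spanZ.
apply: eim_residual_le => //; first exact: ltnW.
- exact: (eim_f_lspan run).
- have [c ->] := lFy; apply: (@lspan_sum _ _ K _ i c F (eim_f_lspan run iN)) => j ji.
  by apply: (eim_f_lspan run); exact: ltn_trans iN.
- by apply: (eim_lower_span run) => //; exact: ltnW.
Qed.

(** The residual of [f_(n+1)] at step [n] is the image under [1 - Pi_n] of its
residual at step [i], which the greedy choice of [f_(i+1)] dominates. *)
Lemma eim_last_residual_le n i : (i <= n)%N -> (n < N)%N ->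
  `|res n| <= (1 + Lam n) * `|res i|.
Proof.
move=> le_in nN; have iN : (i < N)%N := leq_ltn_trans le_in nN.
have N0 : (0 < N)%N by exact: leq_ltn_trans nN.
have L0 : 0 <= 1 + Lam n by rewrite addr_ge0// lebesgue_ge0// ltnW.
apply: (@le_trans _ _ ((1 + Lam n) * `|f n.+1 - P i (f n.+1)|)).
  apply: eim_residual_le => //; first exact: ltnW.
  - exact: (eim_f_lspan run).
  - by apply: (eim_interp_lspan bL run); [exact: ltnW|exact: (eim_f_lspan run)].
  - by apply: lower_span_mono le_in _; exact: eim_interp_lower.
rewrite ler_wpM2l//; have [_ _ /(_ i.+1 iN) /= [[_ +] _ _ _]] := run; apply.
by have [_ _ /(_ n.+1 nN) [[]]] := run.
Qed.

Lemma eim_errorE n : (n < N)%N -> eim_error K ell g n = `|res n|.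
Proof.
move=> nN; have [_ _ /(_ n.+1 nN) /= [[Kf maxf] _ _ _]] := run.
apply/eqP; rewrite eq_le; apply/andP; split.
  apply: ge_sup; first by exists `|res n|; exists (f n.+1).
  by move=> _ [h Kh <-]; exact: maxf.
apply: ub_le_sup; last by exists (f n.+1).
by exists `|res n| => _ [h Kh <-]; exact: maxf.
Qed.

Lemma sym_hull_covered n (c : 'I_(2 ^ n) -> X) (e : R) : (n <= N)%N ->
  sym_hull K `<=` \bigcup_(i in [set: 'I_(2 ^ n)]) ball (c i) e ->
  crosspolytope_covered F c e.
Proof.
move=> nN cov t t1.
have /cov[j _] : sym_hull K (\sum_(i < n) t i *: f i.+1).
  apply: subset_closure; exists n, t, (fun i => f i.+1); split => // i.
  have iN : (i < N)%N by exact: leq_trans (ltn_ord i) nN.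
  by have [_ _ /(_ i.+1 iN) [[]]] := run.
by rewrite -ball_normE => ?; exists j.
Qed.

(** A compact set is bounded, and one ball repeated [2 ^ n] times covers the
hull. *)
Lemma entropy_set_neq0 n : compact K ->
  exists e : R, 0 < e /\ exists c : 'I_(2 ^ n) -> X,
    sym_hull K `<=` \bigcup_(i in [set: 'I_(2 ^ n)]) ball (c i) e.
Proof.
move=> /compact_bounded[M [_ HM]].
pose B := `|M| + 1.
have B0 : 0 < B by rewrite ltr_wpDl.
have KB x : K x -> `|x| <= B.
  by apply: HM; rewrite /B (le_lt_trans (ler_norm M))// ltrDl.
exists (B + 1); split; first by rewrite ltr_wpDl// ltW.
exists (fun=> 0) => x Sx.
have p0 : (0 < 2 ^ n)%N by rewrite expn_gt0.
exists (Ordinal p0) => //; rewrite -ball_normE /= sub0r normrN.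
have [_ [[m [t [h [Kh t1 ->]]]]]] := Sx _ (nbhsx_ballx x 1 ltr01).
rewrite -ball_normE /= => xs.
rewrite -(subrK (\sum_i t i *: h i) x); apply: le_lt_trans (ler_normD _ _) _.
rewrite addrC; apply: ler_ltD xs; apply: (le_trans (ler_norm_sum _ _ _)).
apply: (@le_trans _ _ ((\sum_i `|t i|) * B)); last by rewrite ler_piMl// ltW.
by rewrite mulr_suml; apply: ler_sum => i _; rewrite normrZ ler_wpM2l// KB.
Qed.

(** The residuals [i < n] are comparable to the last one from below, and their
product is the product of the widths times that of the [1 + Lambda_k]. The
factor with [k = 0] disappears because [Lambda_0 = 0]. *)
Lemma eim_bound n (b : R) : (0 < n <= N)%N -> 0 < b -> compact K ->
  (forall (c : 'I_(2 ^ n) -> X) (e : R) (d : nat -> R), 0 < e ->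
     triangular_widths F d n -> crosspolytope_covered F c e ->
     \prod_(i < n) d i <= (b * e) ^+ n) ->
  eim_error K ell g n.-1 <= (1 + Lam n.-1) *
    (\prod_(1 <= k < n) (1 + Lam k)) `^ (n%:R^-1) * b * entropy_number n (sym_hull K).
Proof.
move=> /andP[n0 nN] b0 cK Hb; have N0 := leq_trans n0 nN.
have L0 k : (k <= N)%N -> 0 < 1 + Lam k by move=> kN; rewrite ltr_pwDl// lebesgue_ge0.
have n1N : (n.-1 < N)%N by rewrite prednK.
have nR : (0 : R) < n%:R by rewrite ltr0n.
set PL := \prod_(1 <= k < n) _.
have PLE : PL = \prod_(k < n) (1 + Lam k).
  rewrite -(big_mkord xpredT (fun k => 1 + Lam k)) big_ltn//.
  by rewrite (lebesgue0 bL run N0) addr0 mul1r.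
have PL0 : 0 < PL.
  by rewrite PLE prodr_gt0// => k _; rewrite L0// ltnW// (leq_trans _ nN).
have PLr0 : 0 < PL `^ n%:R^-1 by rewrite powR_gt0.
have A0 : 0 < (1 + Lam n.-1) * PL `^ n%:R^-1 * b.
  by rewrite !mulr_gt0// L0// ltnW.
rewrite mulrC -ler_pdivrMr//; apply: lb_le_inf; first exact: entropy_set_neq0.
move=> e [e0 [c /(sym_hull_covered nN) cov]].
have := Hb c e _ e0 (eim_triangular_widths nN) cov.
rewrite prodf_div -PLE ler_pdivrMr// => H.
rewrite ler_pdivrMr// eim_errorE//.
have E0 : 0 <= `|res n.-1| / (1 + Lam n.-1) by rewrite divr_ge0// ltW// L0// ltnW.
have : (`|res n.-1| / (1 + Lam n.-1)) ^+ n <= (b * e) ^+ n * PL.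
  apply: le_trans H; have -> : forall a : R, a ^+ n = \prod_(i < n) a.
    by move=> a; rewrite prodr_const card_ord.
  apply: ler_prod => i _; rewrite E0/= ler_pdivrMr ?L0 1?ltnW// mulrC.
  by apply: eim_last_residual_le => //; rewrite -ltnS prednK.
have be0 : 0 <= b * e by rewrite mulr_ge0// ltW.
rewrite -!powR_mulrn// => {}H.
have : `|res n.-1| / (1 + Lam n.-1) <= b * e * PL `^ n%:R^-1.
  apply: (le_powR_cancel nR) => //; first by rewrite mulr_ge0// ltW.
  by rewrite powRM ?(ltW PLr0)// -powRrM mulVf ?gt_eqF// powRr1 ?(ltW PL0).
rewrite ler_pdivrMr ?L0// 1?ltnW// => {}H; apply: (le_trans H).
by rewrite le_eqVlt; apply/orP; left; apply/eqP; ring.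
Qed.

End Reduction.

(** * Clarkson-type inequalities for real numbers *)

Section Scalar.
Context {R : realType}.
Implicit Types (p q s x y a b : R).

Lemma mean_powR r x y : 1 <= r -> 0 <= x -> 0 <= y ->
  (2^-1 * (x + y)) `^ r <= 2^-1 * (x `^ r + y `^ r).
Proof.
move=> r1 x0 y0; rewrite !mulrDr.
rewrite {2 4}(_ : 2^-1 = 1 - 2^-1); last by rewrite {2}(splitr 1) div1r addrK.
by apply: (convex_powR r1 (Itv01 _ _)) => //=;
  rewrite ?inE/= ?in_itv/= ?x0 ?y0// ?invr_ge0// invf_le1 ?ler1n.
Qed.

(** Normalize the sum to [1] and use [t `^ r <= t] on the unit interval. *)
Lemma powR_superadditive r x y : 1 <= r -> 0 <= x -> 0 <= y ->
  x `^ r + y `^ r <= (x + y) `^ r.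
Proof.
move=> r1 x0 y0; have [w0|w0] := eqVneq (x + y) 0.
  move: w0 => /eqP; rewrite paddr_eq0// => /andP[/eqP-> /eqP->].
  by rewrite addr0 powR0 ?addr0// gt_eqF//; lra.
have wp : 0 < x + y by rewrite lt_neqAle eq_sym w0 addr_ge0.
have le z : 0 <= z -> z <= x + y -> z `^ r <= (x + y) `^ r * (z / (x + y)).
  move=> z0 zw; have t0 : 0 <= z / (x + y) by rewrite divr_ge0// ltW.
  have {1}-> : z = (x + y) * (z / (x + y)) by rewrite mulrC divfK.
  rewrite powRM ?(ltW wp)// ler_pM2l ?powR_gt0//.
  move: t0; rewrite le_eqVlt => /predU1P[<-|t0].
    by rewrite powR0// gt_eqF//; lra.
  by apply: ge1r_powR => //; rewrite t0 ler_pdivrMr// mul1r.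
apply: (le_trans (lerD (le x x0 _) (le y y0 _))); rewrite ?lerDl ?lerDr//.
by rewrite -mulrDr -mulrDl divff// mulr1.
Qed.

(** Young's inequality, in the form of the weighted mean inequality. *)
Lemma young_powR s x y : 0 < s < 1 -> 0 <= x -> 0 <= y ->
  x `^ (1 - s) * y `^ s <= (1 - s) * x + s * y.
Proof.
move=> /andP[s0 s1] x0 y0; have s1' : 0 < 1 - s by lra.
have := @conjugate_powR _ (x `^ (1 - s)) (y `^ s) (1 - s)^-1 s^-1 (powR_ge0 _ _) (powR_ge0 _ _).
rewrite !invr_gt0 !invrK subrK => /(_ s1' s0 erefl).

by rewrite -!powRrM !mulfV ?gt_eqF// !powRr1// [x * _]mulrC [y * _]mulrC.
Qed.

(** Both [x `^ s >= 1 + s * ln x] and [ln x = 2 * ln (sqrt x) >=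
2 * (1 - (sqrt x)^-1)] come from [expR y >= 1 + y]. The constant [s] stays in
front of the second-order gain, uniformly as [s] tends to [0]. *)
Lemma powR_ge_tangent s x : 0 < s -> 0 <= x ->
  x + 2 * s * (x - Num.sqrt x) <= x `^ (1 + s).
Proof.
move=> s0; rewrite le_eqVlt => /predU1P[<-|x0].
  by rewrite sqrtr0 subrr mulr0 add0r powR_ge0.
rewrite powRD; last by rewrite [x == 0]gt_eqF ?implybT.
rewrite powRr1 ?(ltW x0)//.
have y0 : 0 < Num.sqrt x by rewrite sqrtr_gt0.
have xE : x = Num.sqrt x * Num.sqrt x by rewrite -expr2 sqr_sqrtr// ltW.
have h1 : 1 + s * ln x <= x `^ s by rewrite /powR gt_eqF// expR_ge1Dx.
have h2 : - ln (Num.sqrt x) <= (Num.sqrt x)^-1 - 1.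
  rewrite -lnV ?posrE//.
  have := @le_ln1Dx _ ((Num.sqrt x)^-1 - 1); rewrite subrKC; apply.
  by rewrite ltrBrDl subrr invr_gt0.
have h3 : ln x = 2 * ln (Num.sqrt x) by rewrite {1}xE lnM ?posrE// mulr_natl.
apply: (@le_trans _ _ (x * (1 + s * ln x))); last by rewrite ler_pM2l.
rewrite [leRHS]mulrDr mulr1 lerD2l h3.
have -> : 2 * s * (x - Num.sqrt x) = x * (s * (2 * (1 - (Num.sqrt x)^-1))).
  by rewrite {1 3}xE; field; rewrite gt_eqF.
rewrite ler_pM2l// ler_pM2l// ler_pM2l//; lra.
Qed.

Lemma sqrtD1_le t : 0 <= t <= 1 ->
  Num.sqrt (1 + t) + Num.sqrt (1 - t) <= 2 - t ^+ 2 / 4 :> R.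
Proof.
move=> /andP[t0 t1].
have hu : Num.sqrt (1 + t) ^+ 2 = 1 + t by rewrite sqr_sqrtr//; lra.
have hv : Num.sqrt (1 - t) ^+ 2 = 1 - t by rewrite sqr_sqrtr//; lra.
set u := Num.sqrt (1 + t) in hu *; set v := Num.sqrt (1 - t) in hv *.
have u0 : 0 <= u by exact: sqrtr_ge0.
have v0 : 0 <= v by exact: sqrtr_ge0.
have t2 : t ^+ 2 <= 1 by rewrite expr_le1.
(* (u + v) ^+ 2 = 2 + 2 * u * v, where u * v is the root of 1 - t ^+ 2. *)
have uv : u * v <= 1 - t ^+ 2 / 2.
  rewrite -ler_sqr ?nnegrE ?mulr_ge0//; last by lra.
  rewrite exprMn hu hv; have := sqr_ge0 (t ^+ 2); nra.
rewrite -ler_sqr ?nnegrE ?(addr_ge0 u0 v0)//; last by lra.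
have := sqr_ge0 (t ^+ 2); rewrite sqrrD hu hv; nra.
Qed.

(** The case [p = 1 + s <= 2] has only a gain of order [s = p - 1] over
convexity; this is what makes the exponent [p / (p - 1)] appear. *)
Lemma powR_pair_ge s t : 0 < s -> 0 <= t <= 1 ->
  1 + s * (t ^+ 2 / 4) <= 2^-1 * ((1 + t) `^ (1 + s) + (1 - t) `^ (1 + s)).
Proof.
move=> s0 t01; have := sqrtD1_le t01; move/andP: t01 => [t0 t1] h.
have h1 := @powR_ge_tangent s (1 + t) s0 (addr_ge0 ler01 t0).
have h2 : _ <= (1 - t) `^ (1 + s) := powR_ge_tangent s0 (_ : 0 <= 1 - t).
have {}h2 := h2 (ltac:(lra)).
set u := Num.sqrt (1 + t) in h h1; set v := Num.sqrt (1 - t) in h h2.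
have : s * (t ^+ 2 / 4) <= s * (2 - (u + v)) by rewrite ler_pM2l//; lra.
lra.
Qed.

(** Young's inequality replaces each product by a convex combination:
[a `^ (1 - s) * y `^ (1 + s) <= (1 - s) * a + s * y `^ q] with
[q = (1 + s) / s >= 2], and [y `^ q <= y ^+ 2] on the unit interval. *)
Lemma clarkson_normalized s t a b : 0 < s < 1 -> 0 <= t <= 1 ->
  0 <= a -> 0 <= b -> a + b <= 1 ->
  a `^ (1 - s) + b `^ (1 - s) * (t / 2) `^ (1 + s) <= 1 + s * (t ^+ 2 / 4) /\
  a `^ (1 - s) * t `^ (1 + s) + b `^ (1 - s) * (2^-1) `^ (1 + s) <= 1 + s * (t ^+ 2 / 4).
Proof.
move=> s01 /andP[t0 t1] a0 b0 ab.
have /andP[s0 s1] := s01.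
have pw x : 0 <= x -> x <= 1 -> x `^ (1 + s) = (x `^ ((1 + s) / s)) `^ s.
  by move=> x0 x1; rewrite -powRrM divfK// gt_eqF.
have q2 : 2 <= (1 + s) / s by rewrite ler_pdivlMr//; lra.
have sq x : 0 <= x -> x <= 1 -> x `^ ((1 + s) / s) <= x ^+ 2.
  move=> x0 x1; rewrite -powR_mulrn//.
  move: x0; rewrite le_eqVlt => /predU1P[<-|x0].
    by rewrite !powR0// gt_eqF//; lra.
  by apply: ger_powR => //; rewrite x0.
have half0 : 0 <= 2^-1 :> R by rewrite invr_ge0.
have half1 : 2^-1 <= 1 :> R by lra.
(* (1 + s) / s >= 2 is the exponent conjugate to 1 + s *)
have Y x y : 0 <= x -> 0 <= y -> y <= 1 -> x `^ (1 - s) * y `^ (1 + s) <= (1 - s) * x + s * y ^+ 2.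
  move=> x0 y0 y1; rewrite pw//; apply: le_trans (young_powR s01 x0 (powR_ge0 _ _)) _.
  by rewrite lerD2l ler_pM2l// sq.
have Y1 := Y a 1 a0 ler01 (lexx _); rewrite powR1 mulr1 in Y1.
have Y2 : _ := Y b (t / 2) b0 _ _.
have {}Y2 := Y2 (ltac:(lra)) (ltac:(lra)).
have Y3 := Y a t a0 t0 t1.
have Y4 := Y b 2^-1 b0 half0 half1.
have sab : (1 - s) * (a + b) <= 1 - s by rewrite ler_piMr//; lra.
have st : s * t ^+ 2 <= s by rewrite ler_piMr ?expr_le1//; lra.
rewrite expr1n in Y1; rewrite expr_div_n in Y2.
split; lra.
Qed.

(** The supremum of the left-hand side over the weights [a] and [b] is
[(S `^ q + D `^ q) `^ (p - 1)] with [q = p / (p - 1)], where [S] and [D] are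
the bases of the two powers, so the family of
inequalities is Clarkson's second inequality up to constants. Unlike it, each
member is linear in [p]-th powers and survives integration. *)
Lemma clarkson_scalar_le2 p a b (x y : R) : 1 < p < 2 ->
  0 <= a -> 0 <= b -> a + b <= 1 ->
  a `^ (2 - p) * `|2^-1 * (x + y)| `^ p + b `^ (2 - p) * (4^-1 * `|x - y|) `^ p <=
  2^-1 * (`|x| `^ p + `|y| `^ p).
Proof.
move=> /andP[p1 p2] a0 b0 ab.
pose s := p - 1; have s01 : 0 < s < 1 by rewrite /s; apply/andP; split; lra.
have -> : p = 1 + s by rewrite /s; ring.
have -> : 2 - (1 + s) = 1 - s by ring.
pose S := 2^-1 * (x + y); pose D := 2^-1 * (x - y).
have -> : 4^-1 * `|x - y| = `|D| / 2.
  by rewrite /D normrM ger0_norm ?invr_ge0//; field.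
rewrite -/S; have -> : x = S + D by rewrite /S /D; field.
have -> : y = S - D by rewrite /S /D; field.
move: S D => {x y} S D; have s0 : 0 < s by case/andP: s01.
have s1n : 1 + s != 0 by rewrite gt_eqF//; lra.
have pw x y : 0 <= x -> 0 <= y -> (x * y) `^ (1 + s) = x `^ (1 + s) * y `^ (1 + s).
  by move=> *; rewrite powRM.
have sym : `|S + D| `^ (1 + s) + `|S - D| `^ (1 + s) =
  (`|S| + `|D|) `^ (1 + s) + `|(`|S| - `|D|)| `^ (1 + s).
  have [S0|S0] := leP 0 S; have [D0|D0] := leP 0 D.
  - by rewrite !(ger0_norm (addr_ge0 S0 D0)) (ger0_norm S0) (ger0_norm D0).
  - rewrite (ger0_norm S0) (ltr0_norm D0) opprK addrC (ger0_norm (_ : 0 <= S - D))//; lra.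
  - rewrite (ltr0_norm S0) (ger0_norm D0) (ler0_norm (_ : S - D <= 0)); last lra.
    rewrite addrC opprB [D - S]addrC; congr (_ + _); rewrite -normrN; congr (`|_| `^ _); ring.
  - rewrite (ltr0_norm S0) (ltr0_norm D0) (ler0_norm (_ : S + D <= 0)); last lra.
    rewrite opprD; congr (_ + _); rewrite -normrN; congr (`|_| `^ _); ring.
rewrite sym; have := normr_ge0 S; have := normr_ge0 D.
move: `|S| `|D| => {sym} {}S {}D D0 S0.
(* The scalar inequality is not symmetric in S and D, but the normalized one
   covers both orders. *)
have [DS|SD] := leP D S.
- move: S0; rewrite le_eqVlt => /predU1P[SE|S0].
    have DE : D = 0 by apply/eqP; rewrite eq_le D0 SE DS.
    by rewrite -SE DE mul0r addr0 subrr normr0 powR0// !mulr0 !addr0 mulr0.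
  pose t := D / S; have DE : D = S * t by rewrite /t mulrC divfK// gt_eqF.
  have t01 : 0 <= t <= 1 by rewrite divr_ge0 ?(ltW S0)//= ler_pdivrMr// mul1r.
  have [h _] := clarkson_normalized s01 t01 a0 b0 ab.
  have h2 := powR_pair_ge s0 t01; have /andP[t0 t1] := t01.
  have e1 : S + S * t = S * (1 + t) by ring.
  have e2 : S - S * t = S * (1 - t) by ring.
  have e3 : S * t / 2 = S * (t / 2) by rewrite mulrA.
  rewrite DE e1 e2 e3.
  rewrite normrM (ger0_norm (ltW S0)) (ger0_norm (_ : 0 <= 1 - t)); last lra.
  rewrite !(pw S) ?(ltW S0)//; try lra.
  have SP : 0 < S `^ (1 + s) by rewrite powR_gt0.
  move: (le_trans h h2); rewrite -(ler_pM2l SP); lra.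
- have D1 : 0 < D by exact: le_lt_trans SD.
  pose t := S / D; have SE : S = D * t by rewrite /t mulrC divfK// gt_eqF.
  have t01 : 0 <= t <= 1 by rewrite divr_ge0//= ler_pdivrMr// mul1r ltW.
  have [_ h] := clarkson_normalized s01 t01 a0 b0 ab.
  have h2 := powR_pair_ge s0 t01; have /andP[t0 t1] := t01.
  rewrite distrC [S + D]addrC.
  have e1 : D + D * t = D * (1 + t) by ring.
  have e2 : D - D * t = D * (1 - t) by ring.
  rewrite SE e1 e2.
  rewrite normrM (ger0_norm (ltW D1)) (ger0_norm (_ : 0 <= 1 - t)); last lra.
  rewrite !(pw D) ?(ltW D1) ?invr_ge0//; try lra.
  have SP : 0 < D `^ (1 + s) by rewrite powR_gt0.
  move: (le_trans h h2); rewrite -(ler_pM2l SP); lra.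
Qed.

(** Superadditivity and convexity of [t `^ (p / 2)] reduce the claim to the
parallelogram identity. *)
Lemma clarkson_scalar_ge2 p (x y : R) : 2 <= p ->
  `|2^-1 * (x + y)| `^ p + (2^-1 * `|x - y|) `^ p <=
  2^-1 * (`|x| `^ p + `|y| `^ p).
Proof.
move=> p2; have r1 : 1 <= p / 2 by lra.
have sq z : 0 <= z -> z `^ p = (z ^+ 2) `^ (p / 2).
  by move=> z0; rewrite -powR_mulrn// -powRrM mulrC divfK.
have h0 : 0 <= 2^-1 * `|x - y| by rewrite mulr_ge0 ?invr_ge0.
rewrite !sq ?normr_ge0//.
apply: (le_trans (powR_superadditive r1 (sqr_ge0 _) (sqr_ge0 _))).
apply: le_trans (mean_powR r1 (sqr_ge0 _) (sqr_ge0 _)).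
rewrite exprMn !real_normK ?num_real// le_eqVlt; apply/orP; left; apply/eqP; congr (_ `^ _).
by field.
Qed.

End Scalar.

(** * From scalar inequalities to power-type convex norms *)

Section Lift.
Context {R : realType} {X : normedModType R}.

(** Every inequality between [p]-th powers of this linear shape passes from
real numbers to vectors. It holds when the [p]-th power of the norm is a sum of
integrals of [p]-th powers of real-valued linear functions of the vector. *)
Definition lifts_scalar_ineq (p : R) := forall a b : R, 0 <= a -> 0 <= b ->
  (forall x y : R, a * `|2^-1 * (x + y)| `^ p + b * `|x - y| `^ p <=
    2^-1 * (`|x| `^ p + `|y| `^ p)) ->
  forall x y : X, a * `|2^-1 *: (x + y)| `^ p + b * `|x - y| `^ p <=
    2^-1 * (`|x| `^ p + `|y| `^ p).

Lemma power_convex_ge2 p : 2 <= p -> lifts_scalar_ineq p -> power_convex (X := X) p 4^-1.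
Proof.
move=> p2 /(_ 1 (2^-1 `^ p) ler01 (powR_ge0 _ _)) H x y.
have h2 : (0 : R) <= 2^-1 by rewrite invr_ge0.
apply: le_trans (H _ x y) => [|{}x {}y]; last first.
  by rewrite mul1r -powRM//; exact: clarkson_scalar_ge2.
rewrite mul1r lerD2l -powRM// ge0_ler_powR ?nnegrE ?mulr_ge0// ?invr_ge0//; first lra.
by rewrite ler_wpM2r//; lra.
Qed.

(** The weights proportional to [S `^ q] and [D `^ q] are optimal: they turn the
family of lifted inequalities into [S `^ q + D `^ q <= T `^ (p - 1)^-1]. *)
Lemma power_convex_le2 p : 1 < p < 2 -> lifts_scalar_ineq p ->
  power_convex (X := X) (p / (p - 1)) 4^-1.
Proof.
move=> p12 H x y; have /andP[p1 p2] := p12.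
pose s := p - 1; have s0 : 0 < s by rewrite /s; lra.
pose q := p / s; have q0 : 0 < q by rewrite divr_gt0//; lra.
rewrite -/s -/q; have p0 : p != 0 by rewrite gt_eqF//; lra.
have h4 : (0 : R) <= 4^-1 by rewrite invr_ge0.
set S := `|2^-1 *: (x + y)|; set D := 4^-1 * `|x - y|.
have S0 : 0 <= S by exact: normr_ge0.
have D0 : 0 <= D by rewrite mulr_ge0 ?normr_ge0.
have Hab a b : 0 <= a -> 0 <= b -> a + b <= 1 ->
    a `^ (2 - p) * S `^ p + b `^ (2 - p) * D `^ p <= 2^-1 * (`|x| `^ p + `|y| `^ p).
  move=> a0 b0 ab.
  have := H (a `^ (2 - p)) (b `^ (2 - p) * 4^-1 `^ p) (powR_ge0 _ _).
  rewrite mulr_ge0 ?powR_ge0// => /(_ isT) h.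
  have := h _ x y; rewrite -!mulrA -(powRM _ h4 (normr_ge0 _)); apply => x' y'.
  by rewrite -mulrA -powRM//; exact: clarkson_scalar_le2.
clearbody S D.
set T := 2^-1 * _ in Hab; set M := S `^ q + D `^ q.
have T0 : 0 <= T by rewrite mulr_ge0 ?invr_ge0// addr_ge0 ?powR_ge0.
have MT : M <= T `^ s^-1.
  have [M0|M0] := eqVneq M 0; first by rewrite M0 powR_ge0.
  have Mp : 0 < M by rewrite lt_neqAle eq_sym M0 addr_ge0 ?powR_ge0.
  have := Hab (S `^ q / M) (D `^ q / M).
  rewrite !divr_ge0 ?powR_ge0 ?(ltW Mp)// -mulrDl divff// => /(_ isT isT (lexx _)).
  have term z : 0 <= z -> (z `^ q / M) `^ (2 - p) * z `^ p = z `^ q / M `^ (2 - p).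
    move=> z0; rewrite powRM ?powR_ge0 ?invr_ge0 ?(ltW Mp)//.
    rewrite -[M^-1]powR_inv1 ?(ltW Mp)// -(powRrM M) mulN1r powRN mulrAC; congr (_ / _).
    rewrite -powRrM; move: z0; rewrite le_eqVlt => /predU1P[<-|z0].
      by rewrite [0 `^ p]powR0// mulr0 powR0// gt_eqF.
    rewrite -powRD; last by rewrite [z == 0]gt_eqF ?implybT.
    by congr (_ `^ _); rewrite /q /s; field; rewrite subr_eq0 gt_eqF.
  rewrite [X in X + _ <= _](term S S0) [X in _ + X <= _](term D D0) -mulrDl -/M => h.
  apply: (@le_powR_cancel _ s) => //; rewrite ?powR_ge0// ?(ltW Mp)//.
  rewrite -powRrM mulVf ?gt_eqF// powRr1//; apply: le_trans h.
  rewrite -powRN -{2}(powRr1 (ltW Mp)) -powRD; last by rewrite M0 implybT.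
  by rewrite /s le_eqVlt; apply/orP; left; apply/eqP; congr (_ `^ _); ring.
apply: (le_trans MT); rewrite /T.
apply: le_trans (mean_powR _ (powR_ge0 _ _) (powR_ge0 _ _)) _.
  by rewrite -invr1 lef_pV2 ?posrE// /s; lra.
by rewrite -!powRrM.
Qed.

End Lift.

(** * Boxes, open sets and continuous functions are Lebesgue measurable *)

Section LebesgueRd.
Context {R : realType} {d : nat}.
Local Notation E := 'rV[R]_d.+1.
Local Notation mu := (@lebesgue_Rd R d).
Local Notation T := (caratheodory_type (lebesgue_outer_measure R d)).
Local Open Scope ereal_scope.

(** Cutting a box by a coordinate hyperplane into two boxes does not increase
the total volume; degenerate boxes, whose volume is truncated to [0], make this
an inequality. *)
Lemma split_box_volume (i : 'I_d.+1) (c : R) (ab : E * E) :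
  box_volume (ab.1, (\row_j if j == i then Num.min (ab.2 ord0 j) c else ab.2 ord0 j)%R)
  + box_volume ((\row_j if j == i then Num.max (ab.1 ord0 j) c else ab.1 ord0 j)%R, ab.2)
  <= box_volume ab.
Proof.
rewrite /box_volume -EFinD lee_fin /=.
rewrite (bigD1 i)//= [X in (_ + X <= _)%R](bigD1 i)//= [X in (_ <= X)%R](bigD1 i)//= !mxE eqxx.
set P1 := (\prod_(_ | _) _)%R; set P2 := (\prod_(_ | _) _)%R; set P3 := (\prod_(_ | _) _)%R.
have -> : P1 = P3 by apply: eq_bigr => j ji; rewrite mxE (negbTE ji).
have -> : P2 = P3 by apply: eq_bigr => j ji; rewrite mxE (negbTE ji).
rewrite -mulrDl ler_wpM2r//; first by apply: prodr_ge0 => j _; rewrite le_max lexx.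
move: (ab.1 _ _) (ab.2 _ _) => a b; rewrite /Num.max /Num.min.
by repeat case: ltP => ?; lra.
Qed.

(** A cover by boxes splits along the hyperplane into covers of both parts. *)
Lemma measurable_halfspace (i : 'I_d.+1) (c : R) :
  measurable ([set x | x ord0 i <= c]%R : set T).
Proof.
apply: le_caratheodory_measurable => Y.
apply: le_ereal_inf_tmp => _ [B YB <-].
pose B1 k := ((B k).1, (\row_j if j == i then Num.min ((B k).2 ord0 j) c else (B k).2 ord0 j)%R) : E * E.
pose B2 k := ((\row_j if j == i then Num.max ((B k).1 ord0 j) c else (B k).1 ord0 j)%R, (B k).2) : E * E.
apply: (@le_trans _ _ (\sum_(k <oo) box_volume (B1 k) + \sum_(k <oo) box_volume (B2 k))).
  apply: leeD; apply: ereal_inf_lbound.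
  - exists B1 => // x [/YB [k _ Bx] /= xc]; exists k => // j; rewrite /= mxE.
    by have /andP[-> /=] := Bx j; case: eqP => // ->; rewrite le_min xc andbT.
  - exists B2 => // x [/YB [k _ Bx] /= /negP]; rewrite -ltNge => xc; exists k => // j.
    rewrite /= mxE.
    by have /andP[+ ->] := Bx j; rewrite andbT; case: eqP => // ->; rewrite gt_max xc andbT.
rewrite -nneseriesD; last 2 first.
- by move=> *; exact: box_volume_ge0.
- by move=> *; exact: box_volume_ge0.
apply: lee_nneseries => [k _ _|k _]; first by rewrite adde_ge0// box_volume_ge0.
exact: (split_box_volume i c (B k)).
Qed.

Lemma measurable_box (ab : E * E) : measurable (box ab : set T).
Proof.
have -> : box ab = \bigcap_(i in [set: 'I_d.+1])
    ((~` [set x : E | x ord0 i <= ab.1 ord0 i]%R) `&` [set x : E | x ord0 i <= ab.2 ord0 i]%R).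
  apply/seteqP; split => [x bx i _ /=|x bx i].
    by have /andP[] := bx i; rewrite ltNge => /negP.
  by have [/= /negP] := bx i I; rewrite -ltNge => -> ->.
apply: fin_bigcap_measurable; first exact: finite_finset.
by move=> i _; apply: measurableI; [apply: measurableC|]; exact: measurable_halfspace.
Qed.

Lemma lebesgue_box_le (ab : E * E) : mu (box ab) <= box_volume ab.
Proof.
apply: ereal_inf_lbound.
exists (fun k => if k == 0%N then ab else (0, 0)%R); first by move=> x bx; exists 0%N.
rewrite nneseries_recl//; last by move=> k _; exact: box_volume_ge0.
rewrite [X in _ + X]eseries0 ?adde0// => -[//|k] _ _.
by rewrite /box_volume/= big_ord_recl !mxE subrr maxxx mul0r.
Qed.

Lemma lebesgue_box_lty (ab : E * E) : mu (box ab) < +oo.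
Proof. by apply: le_lt_trans (lebesgue_box_le ab) _; rewrite ltry. Qed.

Definition rat_box (q : 'rV[rat]_d.+1 * 'rV[rat]_d.+1) : E * E :=
  (map_mx ratr q.1, map_mx ratr q.2).

(** The margin [e] leaves room for test functions that spill over the upper
faces of the box. *)
Lemma open_rat_box (U : set E) (x : E) : open U -> U x ->
  exists (q : 'rV[rat]_d.+1 * 'rV[rat]_d.+1) (e : R), [/\ (0 < e)%R,
    box (rat_box q) x &
    forall y : E, (forall i, (rat_box q).1 ord0 i <= y ord0 i <= (rat_box q).2 ord0 i + e)%R -> U y].
Proof.
move=> oU Ux; have : nbhs x U by exact: open_nbhs_nbhs.
move=> /nbhs_ballP[e /= e0 xU].
have H i : exists ab : rat * rat, [/\ (x ord0 i - e / 2 < ratr ab.1)%R,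
   (ratr ab.1 < x ord0 i)%R, (x ord0 i < ratr ab.2)%R & (ratr ab.2 < x ord0 i + e / 2)%R].
  have [|a /andP[]] := @rat_in_itvoo R (x ord0 i - e / 2)%R (x ord0 i); first lra.
  have [|b /andP[]] := @rat_in_itvoo R (x ord0 i) (x ord0 i + e / 2)%R; first lra.
  by move=> *; exists (a, b); split.
have /choice[q Hq] := H.
exists (\row_i (q i).1, \row_i (q i).2)%R, (e / 4)%R; split; first by lra.
  by move=> i; rewrite /= !mxE; have [_ -> h _] := Hq i; exact: ltW.
move=> y Hy; apply: xU; split => // i j.
rewrite ord1 -ball_normE/= ltr_norml.
by have := Hy j; rewrite /= !mxE; have [] := Hq j; move=> *; apply/andP; split; lra.
Qed.

(** An open set is the union of the countably many rational boxes that it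
contains. *)
Lemma measurable_open (U : set E) : open U -> measurable (U : set T).
Proof.
move=> oU.
have -> : U = \bigcup_(q in [set q | box (rat_box q) `<=` U]) box (rat_box q).
  apply/seteqP; split => [x Ux|x [q /= qU /qU//]].
  have [q [e [e0 qx qU]]] := open_rat_box oU Ux.
  exists q => //= y qy; apply: qU => i; have /andP[/ltW -> h] := qy i.
  by rewrite (le_trans h)//= lerDl ltW.
rewrite bigcup_mkcond; apply: countable_bigcupT_measurable.
  exact: countableP.
by move=> q; case: ifP => _ //; exact: measurable_box.
Qed.

Lemma measurable_continuous (f : E -> R) : continuous f ->
  measurable_fun setT (f : T -> R).
Proof.
move=> cf.
move/continuousP : cf => cf; apply: (measurability _ (measurable_realfun.RGenOpens.measurableE R)).
move=> _ [_ [a [b ->] <-]]; rewrite setTI; apply: measurable_open.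
exact/cf/interval_open.
Qed.

End LebesgueRd.

(** * The flat functions *)

Section Flat.
Context {R : realType}.

(** With all [n] at once, these functions are closed under derivation up to
linear combinations; [flat 0] is the usual smooth function that vanishes on the
negative half-line. *)
Definition flat (n : nat) (t : R) : R :=
  if 0 < t then t^-1 ^+ n * expR (- t^-1) else 0.

Lemma flat_ge0 n t : 0 <= flat n t.
Proof.
rewrite /flat; case: ifP => // t0.
by rewrite mulr_ge0 ?expR_ge0// exprn_ge0// invr_ge0 ltW.
Qed.

Lemma flat0_le1 t : flat 0 t <= 1.
Proof.
rewrite /flat; case: ifP => // t0; rewrite expr0 mul1r -[leRHS]expR0 ler_expR.
by rewrite oppr_le0 invr_ge0 ltW.
Qed.

(** The exponential dominates [t^-1 ^+ n.+2]. The square gives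
differentiability at the origin. *)
Lemma flat_le_sqr n t : flat n t <= (n.+2)`!%:R * t ^+ 2.
Proof.
have f0 : (0 : R) < n.+2`!%:R by rewrite ltr0n fact_gt0.
rewrite /flat; case: ifP => t0; last by rewrite mulr_ge0 ?ler0n// sqr_ge0.
have u0 : 0 < t^-1 by rewrite invr_gt0.
rewrite expRN ler_pdivrMr ?expR_gt0//.
have := expR_ge1Dxn n.+1 (ltW u0) => h.
apply: (@le_trans _ _ (n.+2`!%:R * t ^+ 2 * (t^-1 ^+ n.+2 / n.+2`!%:R))).
  rewrite le_eqVlt; apply/orP; left; apply/eqP.
  rewrite 2!(exprS t^-1); set w := t^-1 ^+ n; field.
  by rewrite !gt_eqF.
rewrite ler_pM2l; last by rewrite mulr_gt0// exprn_gt0.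
by apply: le_trans h; rewrite lerDr.
Qed.

Lemma is_derive_flat n (t : R) :
  is_derive t 1 (flat n) (flat n.+2 t - n%:R * flat n.+1 t).
Proof.
have [t0|t0|->] := ltgtP t 0.
- have -> : flat n.+2 t - n%:R * flat n.+1 t = 0 :> R.
    by rewrite /flat ltNge (ltW t0)/= mulr0 subr0.
  apply: (near_eq_is_derive (f := cst 0)).
  have : \forall x \near t, x < 0 by exact: lt_nbhsl.
  by apply: filterS => x x0; rewrite /flat ltNge (ltW x0).
- have -> : flat n.+2 t - n%:R * flat n.+1 t =
      t^-1 ^+ n * (expR (- t^-1) * t ^- 2) +
      expR (- t^-1) * (- n%:R * t^-1 ^+ n.+1).
    by rewrite /flat t0 -exprVn (exprS t^-1 n.+1) (exprS t^-1 n); ring.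
  apply: (@near_eq_is_derive R R R (fun x : R => x^-1 ^+ n * expR (- x^-1))).
    have : \forall x \near t, 0 < x by exact: lt_nbhsr.
    by apply: filterS => x x0; rewrite /flat x0.
  have tn0 : t != 0 by rewrite gt_eqF.
  have dinv : is_derive t 1 (fun x : R => x^-1) (- t ^- 2).
    by apply: is_derive_eq; [exact: is_deriveV|rewrite [LHS]mulr1].
  have dexp : is_derive t 1 (fun x : R => expR (- x^-1)) (expR (- t^-1) * (t ^- 2)).
    have := @is_derive1_comp R expR (fun x : R => - x^-1) t.
    move=> /(_ _ _ (is_derive_expR _) (is_deriveN dinv)).
    by rewrite opprK.
  have dpow : is_derive t 1 (fun x : R => x^-1 ^+ n) (- n%:R * t^-1 ^+ n.+1).
    have de : is_derive t^-1 1 (@GRing.exp R ^~ n) (n%:R * t^-1 ^+ n.-1).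
      apply: DeriveDef; first exact: exprn_derivable.
      by rewrite exp_derive -[_ *: _]/(_ * _) mulr1.
    have := is_derive1_comp de dinv.
    have -> : n%:R * t^-1 ^+ n.-1 * - t ^- 2 = - n%:R * t^-1 ^+ n.+1; last by [].
    case: n {de} => [|n]; first by rewrite oppr0 !mul0r.
    by rewrite -exprVn (exprS _ n.+1) (exprS _ n) /=; ring.
  exact: (is_deriveM dpow dexp).
- have -> : flat n.+2 0 - n%:R * flat n.+1 0 = 0 :> R.
    by rewrite /flat ltxx mulr0 subr0.
  have cv : h^-1 *: ((flat n \o shift 0) (h *: (1 : R)) - flat n 0) @[h --> 0^'] --> (0 : R).
    apply/cvgr0Pnorm_lt => e e0.
    have C0 : (0 : R) < n.+2`!%:R by rewrite ltr0n fact_gt0.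
    exists (e / n.+2`!%:R); first by rewrite /= divr_gt0.
    move=> h /=; rewrite sub0r normrN ltr_pdivlMr// => he h0.
    rewrite {2}/flat ltxx subr0 addr0 [h *: 1]mulr1 -[_ *: _]/(_ * _).
    rewrite normrM normfV mulrC ltr_pdivrMr ?normr_gt0//.
    rewrite (ger0_norm (flat_ge0 _ _)); apply: (le_lt_trans (flat_le_sqr _ _)).
    rewrite -real_normK ?num_real// expr2 mulrCA mulrA ltr_pM2r ?normr_gt0//.
  by apply: DeriveDef; [apply/cvg_ex; exists 0|exact/cvg_lim].
Qed.

Lemma differentiable_flat n t : differentiable (flat n) t.
Proof. by apply/derivable1_diffP; have [] := is_derive_flat n t. Qed.

Lemma flat_cvg1 (a : R) (u : nat -> R) : 0 < a -> (forall j, j.+1%:R * a <= u j) ->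
  flat 0 (u j) @[j --> \oo] --> (1 : R).
Proof.
move=> a0 Hu.
have u0 j : 0 < u j by apply: lt_le_trans (Hu j); rewrite mulr_gt0.
apply: (@squeeze_cvgr _ _ _ _ (fun j => 1 - a^-1 * j.+1%:R^-1) (cst 1)).
- apply: nearW => j; rewrite flat0_le1 andbT /flat u0 expr0 mul1r.
  apply: (le_trans _ (expR_ge1Dx _)); rewrite lerD2l lerN2 -invfM.
  by rewrite lef_pV2 ?posrE ?mulr_gt0// mulrC.
- rewrite -[X in _ --> X]subr0; apply: cvgB; first exact: cvg_cst.
  rewrite -(mulr0 a^-1); apply: cvgMr; exact: cvg_harmonic.
- exact: cvg_cst.
Qed.

End Flat.

(** * Test functions converging to unions of boxes *)

Section TestFunctions.
Context {R : realType} {d : nat}.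
Local Notation E := 'rV[R]_d.+1.

(** A class of functions stable under partial derivatives, whose members are
differentiable; both properties are proved by induction on the construction,
and together they give smoothness. *)
Inductive elementary : (E -> R) -> Prop :=
| elementary_flat i n (c b : R) : elementary (fun x => flat n (c * x ord0 i + b))
| elementary_cst (k : R) : elementary (fun=> k)
| elementary_add f g : elementary f -> elementary g ->
    elementary (fun x => f x + g x)
| elementary_mul f g : elementary f -> elementary g ->
    elementary (fun x => f x * g x).

Lemma elementary_prod (I : Type) (s : seq I) (F : I -> E -> R) :
  (forall i, elementary (F i)) -> elementary (fun x => \prod_(i <- s) F i x).
Proof.
move=> eF; elim: s => [|i s IH].
  by under eq_fun do rewrite big_nil; exact: elementary_cst.
by under eq_fun do rewrite big_cons; exact: elementary_mul.
Qed.

Lemma differentiable_affine i (c b : R) (x : E) :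
  differentiable (fun x : E => c * x ord0 i + b) x.
Proof.
apply: (@differentiableD _ _ _ (fun x : E => c * x ord0 i) (cst b)) => //.
exact: (differentiableZ c (differentiable_coord x ord0 i)).
Qed.

Lemma derive_affine i (c b : R) (x v : E) :
  'D_v (fun x : E => c * x ord0 i + b) x = c * v ord0 i.
Proof.
apply/cvg_lim => //=.
apply: (@cvg_near_cst R R) => //=; near=> h.
have h0 : h != 0 by near: h; exact: nbhs_dnbhs_neq.
rewrite !mxE -[_ *: _]/(_ * _); field.
exact: h0.
Unshelve. all: by end_near. Qed.

Lemma elementary_differentiable f (x : E) : elementary f -> differentiable f x.
Proof.
elim=> [i n c b|k|{}f g _ df _ dg|{}f g _ df _ dg].
- apply: (@differentiable_comp _ _ _ _ (fun x : E => c * x ord0 i + b) (flat n)).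
    exact: differentiable_affine.
  exact: differentiable_flat.
- exact: differentiable_cst.
- exact: differentiableD.
- exact: differentiableM.
Qed.

Lemma elementary_partial j f : elementary f -> elementary (partial j f).
Proof.
elim=> [i n c b|k|{}f g ef IHf eg IHg|{}f g ef IHf eg IHg].
- have -> : partial j (fun x : E => flat n (c * x ord0 i + b)) =
    (fun x => (c * (delta_mx 0 j : E) ord0 i) *
       (flat n.+2 (c * x ord0 i + b) + - n%:R * flat n.+1 (c * x ord0 i + b))).
    apply/funext => x; rewrite /partial.
    have da := differentiable_affine i c b x.
    have df := @differentiable_flat R n (c * x ord0 i + b).
    rewrite deriveE; last exact: differentiable_comp.
    rewrite (diff_comp da df) /=.
    have -> : 'd (fun x : E => c * x ord0 i + b) x (delta_mx 0 j : E) =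
        c * (delta_mx 0 j : E) ord0 i.
      by rewrite -deriveE// derive_affine.
    rewrite diff1E// derive1E.
    have [_ ->] := is_derive_flat n (c * x ord0 i + b).
    by rewrite mulNr.
  apply: elementary_mul; first exact: elementary_cst.
  apply: elementary_add; first exact: elementary_flat.
  by apply: elementary_mul; [exact: elementary_cst|exact: elementary_flat].
- have -> : partial j (fun _ : E => k) = fun=> 0.
    by apply/funext => x; rewrite /partial derive_cst.
  exact: elementary_cst.
- have -> : partial j (fun x => f x + g x) = fun x => partial j f x + partial j g x.
    apply/funext => x; rewrite /partial.
    by apply: (@deriveD _ _ _ f g); apply: diff_derivable; exact: elementary_differentiable.
  exact: elementary_add.
- have -> : partial j (fun x => f x * g x) =
      fun x => f x * partial j g x + g x * partial j f x.
    apply/funext => x; rewrite /partial.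
    by apply: (@deriveM _ _ f g); apply: diff_derivable; exact: elementary_differentiable.
  by apply: elementary_add; exact: elementary_mul.
Qed.

Lemma smooth_elementary f : elementary f -> smooth f.
Proof.
move=> ef s.
have es : elementary (iter_partial s f).
  by elim: s => //= j s IH; exact: elementary_partial.
split=> [x|i x].
  exact: differentiable_continuous (elementary_differentiable x es).
exact: diff_derivable (elementary_differentiable x es).
Qed.

(** A smooth approximation of the indicator of the half-open box [box ab]. The
product of the slope and the distance to the face must tend to infinity inside
the box, including its upper faces: there the support exceeds the box by
[rho / m.+1], which the slope [m.+1 ^+ 2] outweighs. *)
Definition box_bump (ab : E * E) (rho : R) (m : nat) (x : E) : R :=
  \prod_i (flat 0 (m.+1%:R * x ord0 i + - m.+1%:R * ab.1 ord0 i) *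
           flat 0 (- m.+1%:R ^+ 2 * x ord0 i +
                   m.+1%:R ^+ 2 * (ab.2 ord0 i + rho / m.+1%:R))).

Lemma elementary_box_bump ab rho m : elementary (box_bump ab rho m).
Proof.
by apply: elementary_prod => i; apply: elementary_mul; exact: elementary_flat.
Qed.

Lemma box_bump_itv ab rho m x : 0 <= box_bump ab rho m x <= 1.
Proof.
rewrite /box_bump; apply/andP; split.
  by apply: prodr_ge0 => i _; rewrite mulr_ge0// flat_ge0.
apply: prodr_ile1 => i _; rewrite mulr_ge0 ?flat_ge0//=.
by rewrite mulr_ile1 ?flat_ge0 ?flat0_le1.
Qed.

Lemma box_bump_neq0 ab rho m x : box_bump ab rho m x != 0 ->
  forall i, ab.1 ord0 i < x ord0 i < ab.2 ord0 i + rho / m.+1%:R.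
Proof.
move=> b0 i; have m0 : (0 : R) < m.+1%:R by rewrite ltr0n.
have : flat 0 (m.+1%:R * x ord0 i + - m.+1%:R * ab.1 ord0 i) *
           flat 0 (- m.+1%:R ^+ 2 * x ord0 i +
                   m.+1%:R ^+ 2 * (ab.2 ord0 i + rho / m.+1%:R)) != 0.
  by apply: contraNN b0 => /eqP z; apply/eqP; rewrite /box_bump (bigD1 i)//= z mul0r.
rewrite mulf_eq0 negb_or /flat => /andP[].
case: ifP; last by rewrite eqxx.
rewrite mulNr subr_gt0 ltr_pM2l// => -> _.
case: ifP; last by rewrite eqxx.
by rewrite mulNr addrC subr_gt0 ltr_pM2l// exprn_gt0.
Qed.

Lemma box_bump_cvg ab rho x : 0 < rho ->
  box_bump ab rho m x @[m --> \oo] --> (\1_(box ab) x : R).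
Proof.
move=> rho0; rewrite indicE; have [|] := boolP (x \in box ab).
  rewrite inE => bx; rewrite -[X in _ --> X](_ : \prod_(i < d.+1) (1 * 1) = 1 :> R); last first.
    by rewrite big1// => i _; rewrite mulr1.
  apply: (cvg_big (@mul_continuous R)) => i _; have /andP[ax xb] := bx i.
  apply: cvgM.
    apply: (@flat_cvg1 _ (x ord0 i - ab.1 ord0 i)); first by rewrite subr_gt0.
    by move=> j; rewrite mulNr -mulrBr.
  apply: (@flat_cvg1 _ rho) => // j.
  rewrite mulNr addrC -mulrBr (_ : j.+1%:R * rho = j.+1%:R ^+ 2 * (rho / j.+1%:R)).
    by rewrite ler_pM2l ?exprn_gt0// lerBrDl lerD2r.
  have : j.+1%:R != 0 :> R by rewrite pnatr_eq0.
  by move: j.+1%:R => w w0; field.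
rewrite notin_setE => /existsNP[i /negP nb].
apply: cvg_near_cst.
have Z m : ~~ (ab.1 ord0 i < x ord0 i < ab.2 ord0 i + rho / m.+1%:R) -> box_bump ab rho m x = 0.
  by move=> h; apply/eqP; apply: contraNT h => /box_bump_neq0.
have [xa|ax] := leP (x ord0 i) (ab.1 ord0 i).
  by apply: nearW => m; apply: Z; rewrite ltNge xa.
move: nb; rewrite ax/= -ltNge => bx.
near=> m; apply: Z; rewrite negb_and -!leNgt; apply/orP; right.
have m0 : (0 : R) < m.+1%:R by rewrite ltr0n.
rewrite addrC -lerBrDr ler_pdivrMr// mulrC -ler_pdivrMr ?subr_gt0//.
apply: ltW; apply: (lt_le_trans (truncnS_gt _)); rewrite ler_nat ltnS.
by near: m; exact: nbhs_infty_ge.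
Unshelve. all: by end_near. Qed.

(** One minus the product of the complements approximates the indicator of a
union of boxes that may overlap. *)
Definition cover_bump (B : nat -> E * E) (rho : R) (K m : nat) (x : E) : R :=
  1 - \prod_(k < K) (1 - box_bump (B k) rho m x).

Lemma elementary_cover_bump B rho K m : elementary (cover_bump B rho K m).
Proof.
apply: elementary_add; first exact: elementary_cst.
have -> : (fun x => - \prod_(k < K) (1 - box_bump (B k) rho m x)) =
  fun x => -1 * \prod_(k < K) (1 + -1 * box_bump (B k) rho m x).
  apply/funext => x; rewrite mulN1r; congr (- _).
  by apply: eq_bigr => k _; rewrite mulN1r.
apply: elementary_mul; first exact: elementary_cst.
apply: elementary_prod => k; apply: elementary_add; first exact: elementary_cst.
by apply: elementary_mul; [exact: elementary_cst|exact: elementary_box_bump].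
Qed.

Lemma cover_bump_itv B rho K m x : 0 <= cover_bump B rho K m x <= 1.
Proof.
have h k : 0 <= 1 - box_bump (B k) rho m x <= 1.
  by have /andP[? ?] := box_bump_itv (B k) rho m x; apply/andP; split; lra.
have h0 : 0 <= \prod_(k < K) (1 - box_bump (B k) rho m x).
  by apply: prodr_ge0 => k _; have /andP[] := h k.
have h1 : \prod_(k < K) (1 - box_bump (B k) rho m x) <= 1.
  by apply: prodr_ile1 => k _; exact: h.
by rewrite /cover_bump; apply/andP; split; lra.
Qed.

Lemma cover_bump_cvg B rho K x : 0 < rho ->
  cover_bump B rho K m x @[m --> \oo] -->
    (\1_(\bigcup_(k < K) box (B k)) x : R).
Proof.
move=> rho0; rewrite (_ : \1__ x = 1 - \prod_(k < K) (1 - \1_(box (B k)) x) :> R).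
  apply: cvgB; first exact: cvg_cst.
  apply: (cvg_big (@mul_continuous R)) => k _; apply: cvgB; first exact: cvg_cst.
  exact: box_bump_cvg.
rewrite indicE; have [|] := boolP (x \in _).
  rewrite inE => -[k /= kK bx]; rewrite (bigD1 (Ordinal kK))//= indicE mem_set//.
  by rewrite subrr mul0r subr0.
rewrite notin_setE => nb; rewrite big1 ?subrr// => k _.
rewrite indicE memNset ?subr0// => bx; apply: nb.
by exists (val k) => //=.
Qed.

Definition closed_box (a b : E) : set E :=
  [set x | forall i, x ord0 i \in `[a ord0 i, b ord0 i]].

Lemma compact_closed_box a b : compact (closed_box a b).
Proof.
apply: (@rV_compact R _ (fun i => `[a ord0 i, b ord0 i]%classic)) => i.
exact: segment_compact.
Qed.

Lemma test_function_cover_bump (Omega : set E) (B : nat -> E * E) rho K m (a b : E) :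
  0 < rho -> closed_box a (b + const_mx rho) `<=` Omega ->
  (forall k i, a ord0 i <= (B k).1 ord0 i /\ (B k).2 ord0 i <= b ord0 i) ->
  test_function Omega (cover_bump B rho K m).
Proof.
move=> rho0 COm Bab.
pose S := [set x | cover_bump B rho K m x != 0]; have SC : closure S `<=` closed_box a (b + const_mx rho).
  have /closure_id -> : closed (closed_box a (b + const_mx rho)).
    by apply: compact_closed; [exact: norm_hausdorff|exact: compact_closed_box].
  apply: closure_subset => x /= Sx.
  have [k kx] : exists k : 'I_K, box_bump (B k) rho m x != 0.
    apply: contrapT => /forallNP H; move/negP: Sx; apply; apply/eqP.
    by rewrite /cover_bump big1 ?subrr// => k _; have /negP/negPn/eqP-> := H k; rewrite subr0.
  move=> i; rewrite in_itv/= !mxE; have /andP[ax xb] := box_bump_neq0 kx i.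
  have [aB Bb] := Bab k i.
  rewrite (le_trans aB (ltW ax))/=; apply: (le_trans (ltW xb)); apply: lerD => //.
  by rewrite ler_pdivrMr ?ltr0n// ler_peMr ?(ltW rho0)// ler1n.
split; first exact: smooth_elementary (elementary_cover_bump _ _ _ _).
  apply: subclosed_compact SC; [exact: closed_closure|exact: compact_closed_box].
exact: subset_trans COm.
Qed.

End TestFunctions.

(** * Absolute continuity of the integral *)

Section Absolute.
Local Open Scope ereal_scope.

(** Split [`|f|] into a part bounded by [M] and the excess over [M]; the
integral of the excess is small for large [M] by dominated convergence. *)
Lemma integral_absolutely_continuous d (T : measurableType d) (R : realType)
    (mu : {measure set T -> \bar R}) (D : set T) (f : T -> R) (e : R) :
  measurable D -> mu.-integrable D (EFin \o f) -> (0 < e)%R ->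
  exists2 dl : R, (0 < dl)%R & forall A, measurable A -> A `<=` D ->
    mu A <= dl%:E -> \int[mu]_(x in A) `|f x|%:E <= e%:E.
Proof.
move=> mD iF e0.
have mf : measurable_fun D f by apply/measurable_EFinP; exact: measurable_int iF.
have mnf : measurable_fun D (fun x => `|f x|%R) by exact: measurableT_comp.
pose tail (M : nat) x := Num.max (`|f x| - M%:R)%R 0%R.
have mtail M : measurable_fun D (tail M).
  by apply: measurable_maxr => //; apply: measurable_funB.
have tail0 M x : (0 <= tail M x)%R by rewrite le_max lexx orbT.
have tail_le M x : (`|f x| <= M%:R + tail M x)%R.
  by rewrite -lerBlDl le_max lexx.
have tail_cvg : \int[mu]_(x in D) (tail M x)%:E @[M --> \oo] --> (0 : \bar R).
  have m1 M : measurable_fun D (fun x => (tail M x)%:E) by exact/measurable_EFinP.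
  have ae1 : {ae mu, forall x, D x -> (tail M x)%:E @[M --> \oo] --> (cst 0 x : \bar R)}.
    apply: aeW => x Dx; apply: cvg_near_cst; near=> M.
    congr EFin; apply/max_idPr; rewrite subr_le0.
    apply: ltW; apply: (lt_le_trans (truncnS_gt _)); rewrite ler_nat.
    by near: M; exact: nbhs_infty_ge.
  have ae2 : {ae mu, forall x M, D x -> `|(tail M x)%:E| <= (abse \o (EFin \o f)) x}.
    apply: aeW => x M Dx; rewrite /= lee_fin ger0_norm// /tail ge_max normr_ge0 andbT.
    by rewrite gerBl.
  have [_ _] := dominated_convergence mD m1 (measurable_cst _) ae1 (integrable_abse iF) ae2.
  by rewrite integral0.
have e20 : (0 < e / 2)%R by rewrite divr_gt0.
move/fine_cvgP: tail_cvg => [tfin /(@cvgr_lt R _ _ _ _ 0%R) /(_ _ e20) tlt].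
have [M [finM ltM]] := filter_ex (filterI tfin tlt).
have tM : \int[mu]_(x in D) (tail M x)%:E <= (e / 2)%:E.
  by rewrite -(fineK finM) lee_fin ltW.
exists (e / (2 * M.+1%:R))%R; first by rewrite divr_gt0// mulr_gt0.
move=> A mA AD muA.
have mfA : measurable_fun A f by exact: measurable_funS AD mf.
apply: (@le_trans _ _ (\int[mu]_(x in A) (M%:R%:E + (tail M x)%:E))).
  apply: ge0_le_integral => //.
  - by apply/measurable_EFinP; exact: measurableT_comp.
  - apply: emeasurable_funD; first exact: measurable_cst.
    by apply/measurable_EFinP; exact: measurable_funS AD (mtail M).
  - by move=> x _; rewrite -EFinD lee_fin.
rewrite ge0_integralD//; last first.
  by apply/measurable_EFinP; exact: measurable_funS AD (mtail M).
  by move=> x _; rewrite lee_fin.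
have -> : \int[mu]_(x in A) M%:R%:E = M%:R%:E * mu A.
  exact: (integral_cst mu mA M%:R%:E).
apply: (@le_trans _ _ ((e / 2)%:E + (e / 2)%:E)); last by rewrite -EFinD -splitr.
apply: leeD.
  apply: (@le_trans _ _ (M%:R%:E * (e / (2 * M.+1%:R))%:E)).
    by rewrite lee_wpmul2l// lee_fin.
  rewrite -EFinM lee_fin.
  have -> : (M%:R * (e / (2 * M.+1%:R)) = e / 2 * (M%:R / M.+1%:R))%R.
    by rewrite invfM; ring.
  rewrite ler_piMr ?(ltW e20)//.
  by rewrite ler_pdivrMr// mul1r ler_nat.
apply: le_trans tM; apply: ge0_subset_integral => //.
  exact/measurable_EFinP.
by move=> x _; rewrite lee_fin.
Unshelve. all: by end_near. Qed.
End Absolute.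

(** * The fundamental lemma of the calculus of variations *)

Section BoundedMultiplier.
Context {R : realType} {d : nat}.
Local Notation E := 'rV[R]_d.+1.
Local Notation mu := (@lebesgue_Rd R d).
Local Notation T := (caratheodory_type (lebesgue_outer_measure R d)).
Local Open Scope ereal_scope.

Lemma integrable_box_mul (ab : E * E) (h phi : E -> R) (M : R) :
  measurable_fun setT (h : T -> R) ->
  mu.-integrable (box ab : set T) (EFin \o (h : T -> R)) ->
  measurable_fun setT (phi : T -> R) -> (forall x, `|phi x| <= M)%R ->
  mu.-integrable (box ab : set T) (fun x : T => (h x * phi x)%:E).
Proof.
move=> mh ih mphi phiM; apply: le_integrable (integrableZl (measurable_box ab) M ih).
- exact: measurable_box.
- apply/measurable_EFinP; apply: measurable_funM.
    exact: measurable_funS mh.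
  exact: measurable_funS mphi.
- move=> x _; rewrite /= lee_fin !normrM mulrC ler_wpM2r//.
  exact: le_trans (phiM x) (ler_norm M).
Qed.

End BoundedMultiplier.

Section Fundamental.
Context {R : realType} {d : nat}.
Local Notation E := 'rV[R]_d.+1.
Local Notation mu := (@lebesgue_Rd R d).
Local Notation T := (caratheodory_type (lebesgue_outer_measure R d)).
Variables (Omega : set E) (h : E -> R).
Hypothesis mh : measurable_fun setT (h : T -> R).
Hypothesis ih : forall ab : E * E, mu.-integrable (box ab : set T) (EFin \o (h : T -> R)).
Hypothesis hOmega : forall x, ~ Omega x -> h x = 0.
Hypothesis h0 : forall phi, test_function Omega phi ->
  Rintegral mu Omega (fun x => h x * phi x) = 0.
Local Open Scope ereal_scope.

Section Cover.
Variables (a b : E) (rho : R).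
Hypothesis rho0 : (0 < rho)%R.
Hypothesis abOmega : closed_box a (b + const_mx rho) `<=` Omega.
Let Q : set T := box (a - const_mx 1, b + const_mx rho)%R.

Let mQ : measurable Q. Proof. exact: measurable_box. Qed.

Let closed_box_Q : closed_box a (b + const_mx rho) `<=` Q.
Proof.
move=> x xC i; have := xC i; rewrite /= !mxE in_itv/= => /andP[ax ->].
by rewrite andbT (lt_le_trans _ ax)// gtrBl.
Qed.

Let box_Q : box (a, b) `<=` Q.
Proof.
move=> x xB i; have /= /andP[ax xb] := xB i; rewrite /= !mxE.
by rewrite (lt_trans _ ax) ?gtrBl// (le_trans xb)// lerDl ltW.
Qed.

Variable B : nat -> E * E.
Hypothesis Bab : forall k i, (a ord0 i <= (B k).1 ord0 i /\ (B k).2 ord0 i <= b ord0 i)%R.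

Let box_B k : box (B k) `<=` box (a, b).
Proof.
move=> x xB i; have /andP[ax xb] := xB i; have [h1 h2] := Bab k i.
by rewrite /= (le_lt_trans h1 ax) (le_trans xb h2).
Qed.

Let mB k : measurable (box (B k) : set T). Proof. exact: measurable_box. Qed.

(** The product is supported in [Omega] as well as in [Q]. *)
Lemma integral_mul_cover_bump K m :
  \int[mu]_(x in Q) (h x * cover_bump B rho K m x)%:E = 0.
Proof.
have tf := test_function_cover_bump K m rho0 abOmega Bab.
set phi := cover_bump _ _ _ _ in tf *.
have phiC x : phi x != 0%R -> closed_box a (b + const_mx rho) x.
  move=> /eqP nz; apply: contrapT => nC; apply: nz.
  rewrite /phi /cover_bump big1 ?subrr// => k _.
  have [->|bx] := eqVneq (box_bump (B k) rho m x) 0%R; first by rewrite subr0.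
  exfalso; apply: nC => i; rewrite in_itv/= !mxE.
  have /andP[ax xb] := box_bump_neq0 bx i; have [h1 h2] := Bab k i.
  rewrite (le_trans h1 (ltW ax))/=; apply: (le_trans (ltW xb)); apply: lerD => //.
  by rewrite ler_pdivrMr ?ltr0n// ler_peMr ?(ltW rho0)// ler1n.
have iphi : mu.-integrable Q (fun x : T => (h x * phi x)%:E).
  apply: (integrable_box_mul (M := 1%R) mh (ih _)) => [|x].
    apply: measurable_continuous => x.
    have [/(_ [::]) [c _] _ _] := tf; exact: c.
  have /andP[p0 p1] := cover_bump_itv B rho K m x.
  by rewrite -/phi ger0_norm.
have := h0 tf; rewrite /Rintegral.
have -> : \int[mu]_(x in Omega) (h x * phi x)%:E = \int[mu]_(x in Q) (h x * phi x)%:E.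
  rewrite integral_mkcond [RHS]integral_mkcond; apply: eq_integral => x _.
  rewrite !patchE; case: ifPn => [_|]; case: ifPn => //.
  - rewrite notin_setE => nQ; have [->|/phiC/closed_box_Q//] := eqVneq (phi x) 0%R.
    by rewrite mulr0.
  - by rewrite notin_setE => _ /hOmega ->; rewrite mul0r.
move=> f0; rewrite -[LHS]fineK ?f0//.
exact: integrable_fin_num.
Qed.

Lemma integral_finite_cover K :
  \int[mu]_(x in \bigcup_(k < K) box (B k)) (h x)%:E = 0.
Proof.
set U := \bigcup_(k < K) box (B k).
have mU : measurable (U : set T) by apply: bigcup_measurable => k _; exact: mB.
have UQ : U `<=` Q by move=> x [k _ /box_B/box_Q].
pose psi m := cover_bump B rho K m.
have psi1 m x : (`|psi m x| <= 1)%R.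
  by have /andP[p0 p1] := cover_bump_itv B rho K m x; rewrite ger0_norm.
have mpsi m : measurable_fun setT (psi m : T -> R).
  apply: measurable_continuous => x.
  exact: differentiable_continuous (elementary_differentiable x (elementary_cover_bump B rho K m)).
have mhQ : measurable_fun Q (h : T -> R) by exact: measurable_funS mh.
have m1 m : measurable_fun Q (fun x : T => (h x * psi m x)%:E).
  by apply/measurable_EFinP; apply: measurable_funM => //; exact: measurable_funS (mpsi m).
have m2 : measurable_fun Q (fun x : T => (h x * \1_U x)%:E).
  by apply/measurable_EFinP; apply: measurable_funM.
have ae1 : {ae mu, forall x, Q x -> (h x * psi m x)%:E @[m --> \oo] --> (h x * \1_U x)%:E}.
  apply: aeW => x Qx; apply: cvg_EFin; first exact: nearW.
  by apply: cvgM; [exact: cvg_cst|exact: cover_bump_cvg].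
have ae2 : {ae mu, forall x m, Q x -> `|(h x * psi m x)%:E| <= (abse \o (EFin \o (h : T -> R))) x}.
  by apply: aeW => x m Qx; rewrite /= lee_fin normrM ler_piMr.
have [_ _] := dominated_convergence mQ m1 m2 ae1 (integrable_abse (ih _)) ae2.
under eq_fun do rewrite integral_mul_cover_bump.
move=> /(cvg_lim (@ereal_hausdorff R)); rewrite lim_cst; last exact: ereal_hausdorff.
move=> ->; rewrite -[in LHS](setIidr UQ) integral_mkcondr; apply: eq_integral => x _.
rewrite patchE indicE; case: ifPn => _; by rewrite ?mulr1 ?mulr0.
Qed.

(** Dominated convergence is used twice: for a fixed number [K] of boxes the
test functions converge to the indicator of their union, and then [K] grows.
One passage with [K = m] would not do, since late boxes could spill over a
given point. *)
Lemma integral_cover :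
  \int[mu]_(x in \bigcup_k box (B k)) (h x)%:E = 0.
Proof.
set U := \bigcup_k box (B k).
pose V K := \bigcup_(k < K) box (B k).
have mU : measurable (U : set T) by apply: bigcupT_measurable => k; exact: mB.
have mV K : measurable (V K : set T) by apply: bigcup_measurable => k _; exact: mB.
have UQ : U `<=` Q by move=> x [k _ /box_B/box_Q].
have VQ K : V K `<=` Q by move=> x [k _ /box_B/box_Q].
have mhQ : measurable_fun Q (h : T -> R) by exact: measurable_funS mh.
have indE (W : set T) : W `<=` Q ->
    \int[mu]_(x in W) (h x)%:E = \int[mu]_(x in Q) (h x * \1_W x)%:E.
  move=> WQ; rewrite -[in LHS](setIidr WQ) integral_mkcondr.
  apply: eq_integral => x _.
  by rewrite patchE indicE; case: ifPn => _; rewrite ?mulr1 ?mulr0.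
have m1 K : measurable_fun Q (fun x : T => (h x * \1_(V K) x)%:E).
  by apply/measurable_EFinP; apply: measurable_funM.
have m2 : measurable_fun Q (fun x : T => (h x * \1_U x)%:E).
  by apply/measurable_EFinP; apply: measurable_funM.
have ae1 : {ae mu, forall x, Q x -> (h x * \1_(V K) x)%:E @[K --> \oo] --> (h x * \1_U x)%:E}.
  apply: aeW => x Qx; apply: cvg_near_cst.
  rewrite [\1_U x]indicE; have [|] := boolP (x \in U).
    rewrite inE => -[k _ kx]; exists k.+1 => // K /= kK.
    by rewrite indicE mem_set//; exists k.
  rewrite notin_setE => nU; apply: nearW => K.
  by rewrite indicE memNset// => -[k _ kx]; apply: nU; exists k.
have ae2 : {ae mu, forall x K, Q x -> `|(h x * \1_(V K) x)%:E| <= (abse \o (EFin \o (h : T -> R))) x}.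
  apply: aeW => x K Qx; rewrite /= lee_fin normrM ler_piMr//.
  by rewrite indicE; case: (_ \in _); rewrite ?normr1 ?normr0.
have [_ _] := dominated_convergence mQ m1 m2 ae1 (integrable_abse (ih _)) ae2.
under eq_fun do rewrite -indE// integral_finite_cover.
move=> /(cvg_lim (@ereal_hausdorff R)); rewrite lim_cst; last exact: ereal_hausdorff.
by move=> ->; exact: indE.
Qed.

End Cover.

(** By the definition of the outer measure, [E0] has a cover by boxes whose
measure exceeds that of [E0] by little. The integral of [h] over the cover,
cut down to the box, vanishes, and over the excess it is small by absolute
continuity; so the positive function [h] has integral [0] on [E0]. *)
Lemma negligible_pos_box (a b : E) (rho : R) : (0 < rho)%R ->
  closed_box a (b + const_mx rho) `<=` Omega ->
  mu.-negligible (box (a, b) `&` [set x | 0 < h x]%R : set T).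
Proof.
move=> rho0 abOmega; set E0 : set T := _ `&` _.
have mQ : measurable (box (a, b) : set T) by exact: measurable_box.
have mE0 : measurable E0.
  have := emeasurable_fun_o_infty mQ (_ : measurable_fun _ (EFin \o (h : T -> R))) 0%E.
  by apply; apply/measurable_EFinP; exact: measurable_funS mh.
have E0Q : E0 `<=` box (a, b) by move=> x [].
have finQ : mu (box (a, b)) < +oo by exact: lebesgue_box_lty.
have finE0 : mu E0 \is a fin_num.
  by rewrite ge0_fin_numE//; apply: le_lt_trans finQ; apply: le_measure; rewrite ?inE.
have small e : (0 < e)%R -> \int[mu]_(x in E0) (h x)%:E <= e%:E.
  move=> e0; have [dl dl0 Hdl] := integral_absolutely_continuous mQ (ih _) e0.
  have [_ [B E0B <-] Bsmall] := lb_ereal_inf_adherent dl0 finE0.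
  (* The boxes of the cover, cut down to the box (a, b]. *)
  pose B' k : E * E := (\row_j Num.max (a ord0 j) ((B k).1 ord0 j),
                        \row_j Num.min ((B k).2 ord0 j) (b ord0 j))%R.
  have B'E k x : box (B' k) x <-> box (B k) x /\ box (a, b) x.
    split=> [Bx|[Bx ax] i]; last first.
      have /= /andP[h1 h2] := Bx i; have /= /andP[h3 h4] := ax i.
      by rewrite /= !mxE gt_max le_min h1 h2 h3 h4.
    by split=> i; have /= := Bx i; rewrite !mxE gt_max le_min =>
      /andP[/andP[h1 h2] /andP[h3 h4]]; rewrite /= ?h1 ?h2 ?h3 ?h4.
  have B'ab k i : (a ord0 i <= (B' k).1 ord0 i /\ (B' k).2 ord0 i <= b ord0 i)%R.
    by rewrite /= !mxE le_max lexx ge_min lexx orbT.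
  have intU := integral_cover rho0 abOmega B'ab.
  set U : set T := \bigcup_k box (B' k) in intU.
  have mU : measurable U by apply: bigcupT_measurable => k; exact: measurable_box.
  have UQ : U `<=` box (a, b) by move=> x [k _ /B'E[]].
  have E0U : E0 `<=` U.
    by move=> x E0x; have [k _ kx] := E0B x E0x; exists k => //; apply/B'E; split => //; exact: E0Q.
  have muU : mu U <= mu E0 + dl%:E.
    apply: le_trans (ltW Bsmall); apply: ereal_inf_lbound; exists B => // x [k _ /B'E[kx _]].
    by exists k.
  have mD : measurable (U `\` E0) by exact: measurableD.
  have muD : mu (U `\` E0) <= dl%:E.
    rewrite measureD//; last first.
      by apply: le_lt_trans finQ; apply: le_measure; rewrite ?inE.
    by rewrite setIidr// leeBlDl.
  have mhS A : measurable_fun A (fun x : T => (h x)%:E).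
    by apply/measurable_EFinP; exact: measurable_funS mh.
  have : \int[mu]_(x in E0) (h x)%:E + \int[mu]_(x in U `\` E0) (h x)%:E = 0.
    rewrite -integral_setU//; first by rewrite setDUK.
    by apply/disj_setPS => x [E0x [_ /(_ E0x)]].
  have finE : \int[mu]_(x in E0) (h x)%:E \is a fin_num.
    by apply: integrable_fin_num => //; exact: integrableS (ih (a, b)).
  have finD : \int[mu]_(x in U `\` E0) (h x)%:E \is a fin_num.
    apply: integrable_fin_num => //; apply: integrableS (ih (a, b)) => //.
    by apply: subset_trans UQ; exact: subDsetl.
  have absD : `|\int[mu]_(x in U `\` E0) (h x)%:E| <= e%:E.
    apply: le_trans (le_abse_integral mu mD (mhS _)) _.
    by apply: Hdl => //; apply: subset_trans UQ; exact: subDsetl.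
  move: absD; rewrite -(fineK finE) -(fineK finD) -EFinD !lee_fin => absD [sum0].
  by move: absD; rewrite ler_norml => /andP[? ?]; lra.
have mhE : measurable_fun E0 (fun x : T => (h x)%:E).
  by apply/measurable_EFinP; exact: measurable_funS mh.
have : \int[mu]_(x in E0) `|(h x)%:E| = 0.
  apply/eqP; rewrite eq_le; apply/andP; split; last exact: integral_ge0.
  apply/lee_addgt0Pr => e e0; rewrite add0e.
  apply: le_trans (small e e0); rewrite le_eqVlt; apply/orP; left; apply/eqP.
  by apply: eq_integral => x; rewrite inE => -[_ /= hx]; rewrite gtr0_norm.
move=> /(ae_eq_integral_abs mu mE0 mhE) [N [mN N0 sub]].
exists N; split => // x E0x; apply: sub => /= /(_ E0x) [hx].
by case: E0x => _ /=; rewrite hx ltxx.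
Qed.

End Fundamental.

Section FundamentalLemma.
Context {R : realType} {d : nat}.
Local Notation E := 'rV[R]_d.+1.
Local Notation mu := (@lebesgue_Rd R d).
Local Notation T := (caratheodory_type (lebesgue_outer_measure R d)).
Local Open Scope ereal_scope.

(** Countably many rational boxes with a margin inside [Omega] suffice, and on
each of them the sets where [h] and [- h] are positive are negligible. *)
Lemma fundamental_lemma (Omega : set E) (h : E -> R) :
  open Omega ->
  measurable_fun setT (h : T -> R) ->
  (forall ab : E * E, mu.-integrable (box ab : set T) (EFin \o (h : T -> R))) ->
  (forall x, ~ Omega x -> h x = 0%R) ->
  (forall phi, test_function Omega phi ->
     mu.-integrable (Omega : set T) (fun x : T => (h x * phi x)%:E) /\
     Rintegral mu Omega (fun x => h x * phi x)%R = 0%R) ->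
  mu.-negligible ([set x | h x != 0%R] : set T).
Proof.
move=> oO mh ih hO h0.
have mO : measurable (Omega : set T) by exact: measurable_open.
have ihN ab : mu.-integrable (box ab : set T) (EFin \o ((fun x => - h x)%R : T -> R)).
  exact: integrableN (ih ab).
have hNO x : ~ Omega x -> (- h x)%R = 0%R by move=> /hO ->; rewrite oppr0.
have mhN : measurable_fun setT ((fun x => - h x)%R : T -> R) by exact: measurable_funN.
have hN0 phi : test_function Omega phi ->
    Rintegral mu Omega (fun x => - h x * phi x)%R = 0%R.
  move=> /h0 [iphi phi0].
  have -> : (fun x => - h x * phi x)%R = (fun x => -1 * (h x * phi x))%R.
    by apply/funext => x; rewrite mulN1r mulNr.
  by rewrite (RintegralZl _ mO iphi) phi0 mulr0.
have h0' phi tf := (h0 phi tf).2.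
(* The margin e is needed for the spill-over of the test functions. *)
pose W := fun q : 'rV[rat]_d.+1 * 'rV[rat]_d.+1 =>
  if `[< exists2 e : R, (0 < e)%R &
    closed_box (rat_box q).1 ((rat_box q).2 + const_mx e)%R `<=` Omega >]
  then (box (rat_box q) `&` [set x | h x != 0%R] : set T) else set0.
have negW q : mu.-negligible (W q).
  rewrite /W; case: asboolP => [[e e0 qO]|_]; last exact: negligible_set0.
  apply: negligibleS (negligibleU (negligible_pos_box mh ih hO h0' e0 qO)
    (negligible_pos_box mhN ihN hNO hN0 e0 qO)).
  move=> x [qx /= hx]; have /orP[h1|h1] : (h x < 0)%R || (0 < h x)%R by rewrite -neq_lt.
    by right; split; rewrite /= ?oppr_gt0.
  by left.
have [g gP] : exists g : nat -> 'rV[rat]_d.+1 * 'rV[rat]_d.+1, forall q, exists n, g n = q.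
  exists (fun n => odflt (0, 0)%R (unpickle n)) => q.
  by exists (pickle q); rewrite pickleK.
apply: (negligibleS _ (negligible_bigcup (fun n => negW (g n)))).
move=> x /= hx; have Ox : Omega x by apply: contrapT => /hO h'; rewrite h' eqxx in hx.
have [q [e [e0 qx qO]]] := open_rat_box oO Ox.
have [n gn] := gP q; exists n => //; rewrite gn /W.
case: asboolP => // -[]; exists e => // y yC; apply: qO => i.
by have := yC i; rewrite in_itv/= !mxE.
Qed.

End FundamentalLemma.

(** * Uniqueness and linearity of weak derivatives *)

Section WeakDerivatives.
Context {R : realType} {d : nat}.
Local Notation E := 'rV[R]_d.+1.
Local Notation mu := (@lebesgue_Rd R d).
Local Notation T := (caratheodory_type (lebesgue_outer_measure R d)).
Variables (Omega : set E) (p : R).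
Hypothesis oOmega : open Omega.
Hypothesis p1 : 1 <= p.
Local Open Scope ereal_scope.

Let mOmega : measurable (Omega : set T). Proof. exact: measurable_open. Qed.

Lemma in_Lp_measurable u : in_Lp Omega p%:E u ->
  measurable_fun setT (u \_ Omega : T -> R).
Proof. by rewrite /in_Lp inE => /andP[]; rewrite inE. Qed.

(** Boxes have finite measure, and [t <= 1 + t `^ p] for [t >= 0]. *)
Lemma in_Lp_integrable_box u (ab : E * E) : in_Lp Omega p%:E u ->
  mu.-integrable (box ab : set T) (EFin \o (u \_ Omega : T -> R)).
Proof.
move=> uL; have mu_ := in_Lp_measurable uL.
have iup := Lfun_integrable p1 uL.
have mB : measurable (box ab : set T) by exact: measurable_box.
have i1 : mu.-integrable (box ab : set T) (cst 1).
  apply/integrableP; split; first exact: measurable_cst.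
  under eq_integral do rewrite /= normr1.
  by have := integral_cst mu mB 1; rewrite mul1e => ->; exact: lebesgue_box_lty.
have i2 := integrableS measurableT mB (@subsetT _ _) iup.
apply: le_integrable (integrableD mB i1 i2) => //.
  by apply/measurable_EFinP; exact: measurable_funS mu_.
move=> x _ /=; set w := (u \_ Omega) x; rewrite lee_fin.
rewrite [leRHS]ger0_norm; last by rewrite addr_ge0 ?powR_ge0.
have [w1|w1] := leP `|w|%R 1%R; first by rewrite (le_trans w1)// lerDl powR_ge0.
apply: (@le_trans _ _ (`|w| `^ p)%R); last by rewrite lerDr.
by apply: le1r_powR => //; exact: ltW.
Qed.

Lemma iter_partial_outside (phi : E -> R) (s : seq 'I_d.+1) (x : E) :
  ~ closure [set x | phi x != 0%R] x -> iter_partial s phi x = 0%R.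
Proof.
elim: s x => [|i s IH] x nx /=.
  by apply/eqP; apply: contrapT => h; apply: nx; apply: subset_closure; exact/negP.
have <- : 'D_(delta_mx 0%R i : E) (cst 0%R : E -> R) x = 0%R by rewrite derive_cst.
rewrite /partial.
apply: near_eq_derive.
have oC : open (~` closure [set x | phi x != 0%R]) by apply: closed_openC; exact: closed_closure.
apply: filterS (open_nbhs_nbhs (conj oC nx)) => y /IH ->; by [].
Qed.

Lemma test_function_support phi : test_function Omega phi ->
  exists ab : E * E, closure [set x | phi x != 0%R] `<=` box ab.
Proof.
move=> [_ /compact_bounded[M [_ HM]] _].
exists (const_mx (- (`|M| + 2)), const_mx (`|M| + 2))%R => x Cx i.
have xM : (`|x| <= `|M| + 1)%R.
  by apply: HM Cx; apply: (le_lt_trans (ler_norm M)); rewrite ltrDl.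
have : (`|x ord0 i| <= `|x|)%R.
  rewrite [leRHS](mx_normrE x).
  exact: (le_bigmax _ (fun ij : 'I_1 * 'I_d.+1 => `|x ij.1 ij.2|%R) (ord0, i)).
rewrite /= !mxE => h; have := le_trans h xM.
by rewrite ler_norml => /andP[? ?]; apply/andP; split; lra.
Qed.

Lemma test_function_bounded phi s : test_function Omega phi ->
  exists M : R, forall x, (`|iter_partial s phi x| <= M)%R.
Proof.
move=> tphi; have [sm cp _] := tphi; have [cont _] := sm s.
pose C := closure [set x | phi x != 0%R].
have cC : compact (iter_partial s phi @` C).
  by apply: continuous_compact cp; exact: continuous_subspaceT.
have [M [_ HM]] := compact_bounded cC.
exists (`|M| + 1)%R => x.
have [Cx|nC] := pselect (C x); last by rewrite (iter_partial_outside s nC) normr0 addr_ge0.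
apply: HM; last by exists x.
by apply: (le_lt_trans (ler_norm M)); rewrite ltrDl.
Qed.

(** A derivative of a test function is bounded and vanishes outside a box. *)
Lemma integrable_mul_test u phi s : in_Lp Omega p%:E u -> test_function Omega phi ->
  mu.-integrable (Omega : set T) (fun x : T => (u x * iter_partial s phi x)%:E).
Proof.
move=> uL tphi.
have [ab Cab] := test_function_support tphi.
have [M HM] := test_function_bounded s tphi.
have [/(_ s) [cont _] _ CO] := tphi.
have /(integrable_mkcond _ (measurable_box ab)).1 := integrable_box_mul
  (in_Lp_measurable uL) (in_Lp_integrable_box ab uL) (measurable_continuous cont) HM.
move=> h; apply/(integrable_mkcond _ mOmega).2; apply: eq_integrable h => // x _.
rewrite !patchE; case: ifPn => [xab|]; case: ifPn => [xO|] //.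
  by rewrite mul0r.
rewrite notin_setE => nab; rewrite (iter_partial_outside s) ?mulr0//.
by move=> /Cab.
Qed.

Lemma weak_derivative_unique k (a : multi_index k) u v1 v2 :
  weak_derivatives_in_Lp Omega p%:E a u v1 ->
  weak_derivatives_in_Lp Omega p%:E a u v2 ->
  {ae mu, forall x, Omega x -> v1 x = v2 x}.
Proof.
move=> [L1 w1] [L2 w2].
pose h := (fun x => (v1 \_ Omega) x - (v2 \_ Omega) x)%R.
have mh : measurable_fun setT (h : T -> R).
  by apply: measurable_funB; exact: in_Lp_measurable.
have ih ab : mu.-integrable (box ab : set T) (EFin \o (h : T -> R)).
  apply: (@integrableB _ T R mu (box ab) (measurable_box ab)
    (EFin \o (v1 \_ Omega : T -> R)) (EFin \o (v2 \_ Omega : T -> R)));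
  exact: in_Lp_integrable_box.
have hO x : ~ Omega x -> h x = 0%R.
  by move=> nO; rewrite /h !patchE memNset// subrr.
have h0 phi : test_function Omega phi ->
    mu.-integrable (Omega : set T) (fun x : T => (h x * phi x)%:E) /\
    Rintegral mu Omega (fun x => h x * phi x)%R = 0%R.
  move=> tphi; have i1 := integrable_mul_test [::] L1 tphi.
  have i2 := integrable_mul_test [::] L2 tphi.
  have hE : {in (Omega : set T), (fun x : T => h x * phi x)%R =1
      (fun x : T => v1 x * phi x - v2 x * phi x)%R}.
    by move=> x xO; rewrite /h !patchE xO mulrBl.
  split.
    apply: eq_integrable (integrableB mOmega i1 i2) => // x xO.
    by rewrite hE.
  rewrite (@eq_Rintegral _ T R mu _ _ _ hE) RintegralB//.
  have := w1 phi tphi; rewrite (w2 phi tphi) => /(mulfI _) -> //; first by rewrite subrr.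
  by rewrite signr_eq0.
have [N [mN N0 sub]] := fundamental_lemma oOmega mh ih hO h0.
exists N; split => // x nx; apply: sub => /=; apply: contra_notN nx => /eqP.
by rewrite /h => /eqP h0x Ox; move: h0x; rewrite !patchE mem_set// subr_eq0 => /eqP.
Qed.

Lemma weak_derivatives_linear k (a : multi_index k) (c : R) u0 u1 u2 v1 v2 :
  in_Lp Omega p%:E u0 -> in_Lp Omega p%:E u1 -> in_Lp Omega p%:E u2 ->
  {ae mu, forall x, Omega x -> u0 x = c * u1 x + u2 x}%R ->
  weak_derivatives_in_Lp Omega p%:E a u1 v1 ->
  weak_derivatives_in_Lp Omega p%:E a u2 v2 ->
  weak_derivatives_in_Lp Omega p%:E a u0 (fun x => c * v1 x + v2 x)%R.
Proof.
move=> L0 L1 L2 E0 [M1 w1] [M2 w2].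
have p1E : 1 <= p%:E by rewrite lee_fin.
split.
  rewrite /in_Lp (_ : _ \_ _ = c *: (v1 \_ Omega : T -> R) + (v2 \_ Omega : T -> R))%R.
    exact: (Lfun_submod_closed mu p1E).2.
  by apply/funext => x; rewrite !fctE !patchE; case: ifP => _ //; rewrite scaler0 addr0.
move=> phi tphi; rewrite /mpartial; set s := flatten _.
have i0 := integrable_mul_test s L0 tphi.
have i1 := integrable_mul_test s L1 tphi.
have i2 := integrable_mul_test s L2 tphi.
have j1 := integrable_mul_test [::] M1 tphi.
have j2 := integrable_mul_test [::] M2 tphi.
transitivity (Rintegral mu Omega (fun x => c * (u1 x * iter_partial s phi x) +
    u2 x * iter_partial s phi x))%R.
  have m0 := measurable_int _ i0.
  have m12 := measurable_int _ (integrableD mOmega (integrableZl mOmega c i1) i2).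
  rewrite /Rintegral; congr fine; apply: (ae_eq_integral _ _ mOmega m0 m12).
  apply: (@filterS _ _ (ae_filter_ringOfSetsType mu)) E0 => x H Ox.
  by rewrite H// mulrDl -mulrA.
rewrite RintegralD//; last exact: (integrableZl mOmega c i1).
rewrite RintegralZl//.
have -> : Rintegral mu Omega (fun x => (c * v1 x + v2 x) * phi x)%R =
   (c * Rintegral mu Omega (fun x => v1 x * phi x) + Rintegral mu Omega (fun x => v2 x * phi x))%R.
  rewrite -RintegralZl// -RintegralD//; last exact: (integrableZl mOmega c j1).
  by apply: eq_Rintegral => x _; rewrite mulrDl mulrA.
by rewrite w1// w2// mulrDr mulrCA.
Qed.

End WeakDerivatives.

(** * Clarkson-type inequalities in Sobolev spaces *)

Section SobolevLift.
Context {R : realType} {d : nat}.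
Local Notation E := 'rV[R]_d.+1.
Local Notation mu := (@lebesgue_Rd R d).
Local Notation T := (caratheodory_type (lebesgue_outer_measure R d)).
Variables (X : normedModType R) (Omega : set E) (k : nat) (p : R).
Hypothesis oOmega : open Omega.
Hypothesis p1 : 1 <= p.
Variable rep : X -> E -> R.
Hypothesis rep_Wkp : forall x, in_Wkp Omega k p%:E (rep x).
Hypothesis rep_linear : forall (a : R) (x y : X),
  rep (a *: x + y) = (fun t => a * rep x t + rep y t) %[ae mu in Omega].
Hypothesis rep_norm : forall x, `|x| = Wkp_norm Omega k p%:E (rep x).

Let p0 : p != 0. Proof. by rewrite gt_eqF// (lt_le_trans ltr01). Qed.

Let mOmega : measurable (Omega : set T). Proof. exact: measurable_open. Qed.

Local Notation D a x := (weak_derivative Omega p%:E a (rep x)).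

Lemma rep_weak_derivative (a : multi_index k) x : (mi_order a <= k)%N ->
  weak_derivatives_in_Lp Omega p%:E a (rep x) (D a x).
Proof. by move=> ak; apply: xgetPex; exact: (rep_Wkp x).2. Qed.

Lemma weak_derivative_linear (a : multi_index k) (c : R) x y : (mi_order a <= k)%N ->
  D a (c *: x + y) = (fun t => c * D a x t + D a y t) %[ae mu in Omega].
Proof.
move=> ak; apply: (weak_derivative_unique oOmega p1); first exact: rep_weak_derivative.
apply: (weak_derivatives_linear oOmega p1 _ _ _ (rep_linear c x y));
  try exact: rep_weak_derivative; exact: (rep_Wkp _).1.
Qed.

(** Linearity is only available in the form [a *: x + y]; the value at [0] is
null because [0 = 1 *: 0 + 0]. *)
Lemma weak_derivative_comb (a : multi_index k) (b c : R) x y : (mi_order a <= k)%N ->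
  D a (b *: x + c *: y) = (fun t => b * D a x t + c * D a y t) %[ae mu in Omega].
Proof.
move=> ak; have h0 := weak_derivative_linear 1 0 0 ak.
have h1 := weak_derivative_linear c y 0 ak.
have h2 := weak_derivative_linear b x (c *: y) ak.
rewrite scale1r addr0 in h0; rewrite addr0 in h1.
apply: (@filterS3 _ _ (ae_filter_ringOfSetsType mu)) h0 h1 h2 => t + + + Ot.
move=> /(_ Ot) e0 /(_ Ot) e1 /(_ Ot) ->; rewrite e1; congr (_ + _).
by move: e0; rewrite mul1r => /eqP; rewrite -subr_eq subrr eq_sym => /eqP ->; rewrite addr0.
Qed.

Local Notation F a x := (D a x \_ Omega : T -> R).
Local Notation I f := (Rintegral mu setT (fun t : T => `|f t| `^ p)).

Lemma weak_derivative_Lfun (a : multi_index k) x : (mi_order a <= k)%N ->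
  F a x \in Lfun mu p%:E.
Proof. by move=> ak; have [] := rep_weak_derivative x ak. Qed.

Lemma Lp_norm_powR u : in_Lp Omega p%:E u -> Lp_norm Omega p%:E u `^ p = I (u \_ Omega : T -> R).
Proof.
rewrite /in_Lp /Lp_norm inE => /andP[_]; rewrite inE/= /finite_norm => fN.
have finN : 'N[mu]_p%:E[EFin \o (u \_ Omega : T -> R)]%E \is a fin_num.
  by rewrite ge0_fin_numE// Lnorm_ge0.
have := poweR_Lnorm mu (EFin \o (u \_ Omega : T -> R)) p0.
by rewrite -(fineK finN) poweR_EFin /Rintegral /= => <-.
Qed.

Lemma norm_powR x : `|x| `^ p =
  \sum_(a : multi_index k | (mi_order a <= k)%N) I (F a x).
Proof.
rewrite rep_norm /Wkp_norm -powRrM mulVf// powRr1; last first.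
  by apply: sumr_ge0 => a _; exact: powR_ge0.
apply: eq_bigr => a ak; apply: Lp_norm_powR.
exact: weak_derivative_Lfun.
Qed.

Lemma Lfun_comb (b c : R) (u v : T -> R) : u \in Lfun mu p%:E -> v \in Lfun mu p%:E ->
  (fun t => b * u t + c * v t) \in Lfun mu p%:E.
Proof.
move=> uL vL; have p1E : (1 <= p%:E)%E by rewrite lee_fin.
have lin := (Lfun_submod_closed mu p1E).2.
have -> : (fun t => b * u t + c * v t) = b *: u + (c *: v + 0) by rewrite addr0.
by apply: (lin) => //; apply: (lin) => //; exact: (Lfun_submod_closed mu p1E).1.
Qed.

Lemma integral_weak_derivative_comb (a : multi_index k) (b c : R) x y : (mi_order a <= k)%N ->
  I (F a (b *: x + c *: y)) = I (fun t => b * F a x t + c * F a y t).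
Proof.
move=> ak; have Lx := weak_derivative_Lfun x ak; have Ly := weak_derivative_Lfun y ak.
have Lxy := weak_derivative_Lfun (b *: x + c *: y) ak.
have m1 := measurable_int _ (Lfun_integrable p1 Lxy).
have m2 := measurable_int _ (Lfun_integrable p1 (Lfun_comb b c Lx Ly)).
rewrite /Rintegral; congr fine; apply: (ae_eq_integral _ _ measurableT m1 m2).
apply: (@filterS _ _ (ae_filter_ringOfSetsType mu)) (weak_derivative_comb b c x y ak) => t H _.
congr (_ `^ _)%:E; congr `|_|.
rewrite !patchE; case: ifPn => [|_]; last by rewrite !mulr0 addr0.
by rewrite inE => /H.
Qed.

(** The [p]-th power of the norm is the sum of the integrals of the [p]-th
powers of the weak derivatives, which depend linearly on the vector almost
everywhere. *)
Lemma sobolev_lifts_scalar_ineq : lifts_scalar_ineq (X := X) p.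
Proof.
move=> b c b0 c0 Hbc x y; rewrite !norm_powR !mulr_sumr -!big_split/= mulr_sumr.
apply: ler_sum => a ak.
have Lx := weak_derivative_Lfun x ak; have Ly := weak_derivative_Lfun y ak.
have eS : I (F a (2^-1 *: (x + y))) = I (fun t => 2^-1 * F a x t + 2^-1 * F a y t).
  by rewrite scalerDr; exact: integral_weak_derivative_comb.
have eB : I (F a (x - y)) = I (fun t => 1 * F a x t + -1 * F a y t).
  by rewrite -[x in LHS]scale1r -scaleN1r; exact: integral_weak_derivative_comb.
suff key A B : A = I (fun t => 2^-1 * F a x t + 2^-1 * F a y t) ->
    B = I (fun t => 1 * F a x t + -1 * F a y t) ->
    b * A + c * B <= 2^-1 * (I (F a x) + I (F a y)) by exact: key eS eB.
move=> -> ->.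
have i1 := Lfun_integrable p1 (Lfun_comb 2^-1 2^-1 Lx Ly).
have i2 := Lfun_integrable p1 (Lfun_comb 1 (-1) Lx Ly).
have ix := Lfun_integrable p1 Lx; have iy := Lfun_integrable p1 Ly.
have j1 := integrableZl measurableT b i1; have j2 := integrableZl measurableT c i2.
have j3 := integrableZl measurableT 2^-1 (integrableD measurableT ix iy).
rewrite -(RintegralZl b measurableT i1) -(RintegralZl c measurableT i2).
rewrite -(RintegralD measurableT j1 j2) -(RintegralD measurableT ix iy).
rewrite -(RintegralZl 2^-1 measurableT (integrableD measurableT ix iy)).
apply: (le_Rintegral measurableT (integrableD measurableT j1 j2) j3).
move=> t _ /=; have := Hbc (F a x t) (F a y t).
by rewrite mulrDr mul1r mulN1r.
Qed.

End SobolevLift.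

(** * Hilbert and Sobolev exponents and the three bounds *)

Section Spaces.
Context {R : realType}.

Lemma hilbert_power_convex (X : normedModType R) :
  hilbert_norm X -> power_convex (X := X) 2 2^-1.
Proof.
move=> [ip ipE] x y.
have parallelogram : `|x + y| ^+ 2 + `|x - y| ^+ 2 = 2 * (`|x| ^+ 2 + `|y| ^+ 2).
  have eD : ip (x + y) (x + y) = ip x x + ip x y + (ip y x + ip y y).
    by rewrite linearDl !linearDr.
  have eB : ip (x - y) (x - y) = ip x x - ip x y - (ip y x - ip y y).
    by rewrite linearBl !linearBr.
  by rewrite -!ipE eD eB; ring.
have h2 : (0 : R) <= 2^-1 by rewrite invr_ge0.
rewrite !powR_mulrn ?mulr_ge0// normrZ ger0_norm// !exprMn -mulrDr parallelogram.
by rewrite le_eqVlt; apply/orP; left; apply/eqP; field.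
Qed.

(** The exponent is [q = max (p, p / (p - 1))]. *)
Lemma sobolev_power_convex d (X : normedModType R) (Omega : set 'rV[R]_d.+1) k (p : R) :
  domain Omega -> 1 < p -> is_Wkp X Omega k p%:E ->
  exists2 q, 1 <= q /\ 1 - q^-1 = 2^-1 + `|2^-1 - p^-1| & power_convex (X := X) q 4^-1.
Proof.
move=> [oO _ _] p1 [rep [rW _ rL rN]].
have lift := sobolev_lifts_scalar_ineq oO (ltW p1) rW rL rN.
have pp : p * p^-1 = 1 by rewrite mulfV// gt_eqF// (lt_trans ltr01).
have [p2|p2] := leP 2 p.
  exists p; last exact: power_convex_ge2.
  have : p^-1 <= 2^-1 by rewrite lef_pV2 ?posrE//; lra.
  by move=> h; split; [lra|rewrite ger0_norm; lra].
exists (p / (p - 1)); last by apply: power_convex_le2 => //; rewrite p1.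
have s0 : 0 < p - 1 by lra.
have : 2^-1 <= p^-1 by rewrite lef_pV2 ?posrE//; lra.
move=> h; split; first by rewrite ler_pdivlMr//; lra.
rewrite invf_div mulrBl pp mul1r ler0_norm; lra.
Qed.

End Spaces.

Section Bounds.
Context {R : realType} {X : normedModType R}.
Variables (K : set X) (L : set (X -> R)) (N : nat) (f : nat -> X)
  (ell : nat -> X -> R) (g : nat -> X).
Hypothesis cK : compact K.
Hypothesis bL : forall l, L l -> bounded_functional_on (lspan K) l.
Hypothesis run : eim_run K L N f ell g.
Variable n : nat.
Hypothesis nN : (0 < n <= N)%N.

Local Notation Lam := (lebesgue_constant K ell g).
Local Notation ent := (entropy_number n (sym_hull K)).

Let n0 : (0 < n)%N. Proof. by case/andP: nN. Qed.
Let nR : (0 : R) < n%:R. Proof. by rewrite ltr0n. Qed.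

Lemma eim_error_le_entropy : eim_error K ell g n.-1 <=
  8 * (1 + Lam n.-1) * (\prod_(1 <= k < n) (1 + Lam k)) `^ (n%:R^-1) * n%:R * ent.
Proof.
have b0 : 0 < 8 * n%:R :> R by rewrite mulr_gt0.
apply: le_trans (eim_bound bL run nN b0 cK _) _.
  by move=> c e d e0 Hd; exact: prod_widths_le.
by rewrite le_eqVlt; apply/orP; left; apply/eqP; ring.
Qed.

Lemma eim_error_le_entropy_power (q c : R) :
  1 <= q -> 0 < c -> power_convex (X := X) q c ->
  eim_error K ell g n.-1 <=
  32 / c * (1 + Lam n.-1) * (\prod_(1 <= k < n) (1 + Lam k)) `^ (n%:R^-1) *
    n%:R `^ (1 - q^-1) * ent.
Proof.
move=> q1 c0 cvx.
have b0 : 0 < 32 / c * n%:R `^ (1 - q^-1) by rewrite mulr_gt0 ?divr_gt0 ?powR_gt0.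
apply: le_trans (eim_bound bL run nN b0 cK _) _.
  by move=> b e d e0 Hd; exact: prod_widths_le_power.
by rewrite le_eqVlt; apply/orP; left; apply/eqP; ring.
Qed.

Lemma entropy_ge0 : 0 <= ent.
Proof.
apply: lb_le_inf; first exact: entropy_set_neq0.
by move=> e [/ltW].
Qed.

Lemma lebesgue_factor_ge0 : 0 <= (1 + Lam n.-1) * (\prod_(1 <= k < n) (1 + Lam k)) `^ (n%:R^-1).
Proof.
case/andP: nN => _ nN'; rewrite mulr_ge0 ?powR_ge0// addr_ge0//.
by apply: (lebesgue_ge0 bL run); [exact: leq_trans (leq_pred _) nN'|exact: leq_trans nN'].
Qed.

(** At the price of a factor [2] for [Lambda_(n-1)] and of the [n]-th root of
[2 ^ n] for the product, [1 + Lambda_k] becomes [Lambda_k]. *)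
Lemma lebesgue_factor_le : (1 < n)%N ->
  (1 + Lam n.-1) * (\prod_(1 <= k < n) (1 + Lam k)) `^ (n%:R^-1) <=
  4 * Lam n.-1 * (\prod_(1 <= k < n) Lam k) `^ (n%:R^-1).
Proof.
move=> n1; case/andP: nN => _ nN'.
have L1 k : (1 <= k < n)%N -> 1 <= Lam k.
  move=> /andP[k1 kn]; apply: (lebesgue_ge1 bL run); rewrite k1/=.
  exact: leq_trans (ltnW kn) nN'.
have Ln1 : 1 <= Lam n.-1 by apply: L1; rewrite prednK// -ltnS prednK// n1 leqnn.
have P0 : 0 <= \prod_(1 <= k < n) Lam k.
  by rewrite big_nat; apply: prodr_ge0 => k /L1; lra.
have le : \prod_(1 <= k < n) (1 + Lam k) <= 2 ^+ n * \prod_(1 <= k < n) Lam k.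
  apply: (@le_trans _ _ (\prod_(1 <= k < n) (2 * Lam k))).
    rewrite !big_nat; apply: ler_prod => k /L1 h; apply/andP; split; lra.
  rewrite big_split/= prodr_const_nat ler_wpM2r//.
  by rewrite ler_weXn2l ?leq_subr//; lra.
have P1 : 0 <= \prod_(1 <= k < n) (1 + Lam k).
  by rewrite big_nat; apply: prodr_ge0 => k /L1; lra.
have step : (\prod_(1 <= k < n) (1 + Lam k)) `^ (n%:R^-1) <=
    2 * (\prod_(1 <= k < n) Lam k) `^ (n%:R^-1).
  apply: (@le_trans _ _ ((2 ^+ n * \prod_(1 <= k < n) Lam k) `^ (n%:R^-1))).
    by apply: ge0_ler_powR; rewrite ?nnegrE ?invr_ge0 ?mulr_ge0 ?exprn_ge0// ltW.
  by rewrite powRM ?exprn_ge0// -powR_mulrn// -powRrM mulfV ?gt_eqF// powRr1.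
have -> : 4 * Lam n.-1 * (\prod_(1 <= k < n) Lam k) `^ n%:R^-1 =
  (2 * Lam n.-1) * (2 * (\prod_(1 <= k < n) Lam k) `^ n%:R^-1) by ring.
by apply: ler_pM => //; rewrite ?powR_ge0//; lra.
Qed.

End Bounds.

Theorem corollary3p3 (R : realType) :
  exists C0 : R, 0 < C0 /\
  forall (X : completeNormedModType R) (K : set X) (L : set (X -> R)) (N : nat)
    (f : nat -> X) (ell : nat -> X -> R) (g : nat -> X),
  compact K ->
  (forall l, L l -> bounded_functional_on (lspan K) l) ->
  eim_run K L N f ell g ->
  let Lambda := lebesgue_constant K ell g in
  forall n : nat, (1 <= n <= N)%N ->
  [/\ eim_error K ell g n.-1 <=
        C0 * (1 + Lambda n.-1) *
        (\prod_(1 <= k < n) (1 + Lambda k)) `^ (n%:R^-1) *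
        n%:R * entropy_number n (sym_hull K),
      (forall (d : nat) (Omega : set 'rV[R]_d.+1) (k : nat) (p : \bar R),
        domain Omega -> (1 <= p)%E -> is_Wkp X Omega k p ->
        eim_error K ell g n.-1 <=
          C0 * (1 + Lambda n.-1) *
          (\prod_(1 <= k < n) (1 + Lambda k)) `^ (n%:R^-1) *
          n%:R `^ (2^-1 + `|2^-1 - fine (p^-1)%E|) *
          entropy_number n (sym_hull K)) &
      (hilbert_norm X -> (2 <= n)%N ->
        eim_error K ell g n.-1 <=
          C0 * Lambda n.-1 *
          (\prod_(1 <= k < n) Lambda k) `^ (n%:R^-1) *
          n%:R `^ 2^-1 * entropy_number n (sym_hull K))].
Proof.
(* 128 suffices for Sobolev spaces; the Hilbert case has 64 * 4, the factor 4
   coming from the Lebesgue constants. *)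
exists 256; split; first by rewrite ltr0n.
move=> X K L N f ell g cK bL run Lam n nN.
have F0 := lebesgue_factor_ge0 bL run nN.
have e0 := entropy_ge0 cK n.
have enlarge (C A : R) : 0 <= A -> C <= 256 ->
    C * (1 + Lam n.-1) * (\prod_(1 <= k < n) (1 + Lam k)) `^ (n%:R^-1) * A *
      entropy_number n (sym_hull K) <=
    256 * (1 + Lam n.-1) * (\prod_(1 <= k < n) (1 + Lam k)) `^ (n%:R^-1) * A *
      entropy_number n (sym_hull K).
  move=> A0 C256; rewrite -!(mulrA C) -!(mulrA 256) ler_wpM2r//.
  exact: mulr_ge0 (mulr_ge0 F0 A0) e0.
have general : eim_error K ell g n.-1 <=
    256 * (1 + Lam n.-1) * (\prod_(1 <= k < n) (1 + Lam k)) `^ (n%:R^-1) *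
    n%:R * entropy_number n (sym_hull K).
  by apply: le_trans (eim_error_le_entropy cK bL run nN) _; apply: enlarge => //; lra.
split=> [//|d Omega k p dO p1 W|hX n2].
- have n1 : n%:R `^ 1 = n%:R :> R by rewrite powRr1.
  case: p p1 W => [p|_ _|//].
  + rewrite lee_fin le_eqVlt => /predU1P[<-|p1] W.
      by rewrite inver oner_eq0 /= invr1 (_ : 2^-1 + _ = 1) ?n1// ler0_norm; lra.
    rewrite inver gt_eqF ?(lt_trans ltr01)//=.
    have [q [q1 qE] cvx] := sobolev_power_convex dO p1 W.
    have c0 : (0 : R) < 4^-1 by rewrite invr_gt0.
    apply: le_trans (eim_error_le_entropy_power cK bL run nN q1 c0 cvx) _.
    by rewrite qE; apply: enlarge; [exact: powR_ge0|rewrite invrK; lra].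
  + by rewrite invey /= subr0 ger0_norm ?invr_ge0// (_ : 2^-1 + 2^-1 = 1) ?n1//; lra.
- have c0 : (0 : R) < 2^-1 by rewrite invr_gt0.
  have le12 : (1 : R) <= 2 by lra.
  have := eim_error_le_entropy_power cK bL run nN le12 c0 (hilbert_power_convex hX).
  rewrite (_ : 1 - 2^-1 = 2^-1 :> R); last by field.
  move=> /le_trans; apply; rewrite -(mulrA (32 / 2^-1)).
  have := lebesgue_factor_le bL run nN n2; rewrite -/Lam => h.
  rewrite ler_wpM2r// ler_wpM2r ?powR_ge0// invrK.
  have -> : 256 * Lam n.-1 * (\prod_(1 <= k < n) Lam k) `^ n%:R^-1 =
     64 * (4 * Lam n.-1 * (\prod_(1 <= k < n) Lam k) `^ n%:R^-1) by ring.
  by rewrite (_ : 32 * 2 = 64 :> R) ?ler_pM2l//; ring.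
Qed.
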